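(* Let $M,N\ge3$ be integers, $0\le\ell_1\le M-3$ and $0\le\ell_2\le N-3$. Then the linear map induced on elementary tensors by $\omega\otimes\eta\mapsto((z,\tau)\mapsto\eta(z)\omega(z\tau))$ restricts to an isomorphism of vector spaces $$\Xi^{(\ell_1,\ell_2)}_{M,N}\colon V^{(\ell_1,\ell_2)}_{M,N}\xrightarrow{\ \sim\ } J^0_{M,N}\cap\mathbb{C}[[z]](\tau)^{(\ell_1,\ell_2)},$$ which is order preserving ($\mathrm{ord}(\Xi^{(\ell_1,\ell_2)}_{M,N}(F))=\mathrm{ord}(F)$) and sign preserving (if $F\in V^{(\ell_1,\ell_2)}_{M,N}\cap(W_M^{0,s_1}\otimes W_N^{0,s_2})$ with $s_1,s_2\in\{+1,-1\}$, then $\Xi^{(\ell_1,\ell_2)}_{M,N}(F)(-z,\tau)=s_1s_2\,\Xi^{(\ell_1,\ell_2)}_{M,N}(F)(z,\tau)$).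
   Context: $e(z):=e^{2\pi iz}$. A weak function of level $N$ is a meromorphic function $\omega$ on $\mathbb{C}$ that is $1$-periodic, holomorphic on $\mathbb{C}\setminus\frac1N\mathbb{Z}$, has at most simple poles at the points $j/N$, and satisfies $\omega(x+iy)=O(|y|^{-A})$ as $|y|\to\infty$ for every $A>0$; $W_N^0$ is the space of those with a removable singularity at $z=0$, $W_N^{0,+1}$/$W_N^{0,-1}$ its even/odd parts, and $W_N^{0,\mathrm{ord}\ge\ell}:=\{\omega\in W_N^0:\mathrm{ord}_{z=0}\omega\ge\ell\}$. $V^{(\ell_1,\ell_2)}_{M,N}:=W_M^{0,\mathrm{ord}\ge\ell_1}\otimes W_N^{0,\mathrm{ord}\ge\ell_2}$. $J^0_{M,N}$ is the $\mathbb{C}$-span of the functions $(z,\tau)\mapsto\eta(z)\omega(z\tau)$, $\omega\in W_M^0$, $\eta\in W_N^0$. For integers $\nu,\mu\ge0$, $\mathbb{C}[[z]](\tau)^{(\nu,\mu)}$ is the space of meromorphic functions on $\mathbb{C}\times\mathbb{C}$ with an expansion $\sum_{j\ge0}P_j(\tau)z^j$ near $z=0$, $P_j$ polynomials of degree $\le j$, $j-\deg P_j\ge\mu$ and $j-\deg(\tau^jP_j(1/\tau))\ge\nu$ for all $j$ ($\deg0:=-\infty$). For such $G$, $\mathrm{ord}(G):=\big(\min_j(j-\deg(\tau^jP_j(1/\tau))),\min_j(j-\deg P_j)\big)$. For each $N$, $\alpha_0^{(N)},\dots,\alpha_{N-3}^{(N)}$ is a fixed basis of $W_N^0$ with $\alpha_j^{(N)}(z)=z^j+O(z^{N-2})$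 and $\alpha_j^{(N)}(-z)=(-1)^j\alpha_j^{(N)}(z)$; for $0\ne F=\sum a_{m,n}\alpha_m^{(M)}\otimes\alpha_n^{(N)}$, $\mathrm{ord}(F):=(\min\{m:\exists n,a_{m,n}\neq0\},\min\{n:\exists m,a_{m,n}\ne0\})$, $\mathrm{ord}(0):=(\infty,\infty)$. *)

(* Defs.v *)
From HB Require Import structures.
From mathcomp Require Import all_boot all_order all_algebra.
From mathcomp Require Import sesquilinear.
From mathcomp Require Import all_classical all_reals all_analysis.
From mathcomp.real_closed Require Import complex.

Set Implicit Arguments.
Unset Strict Implicit.
Unset Printing Implicit Defensive.

Import Order.TTheory GRing.Theory Num.Theory.
Import numFieldNormedType.Exports.

Local Open Scope classical_set_scope.
Local Open Scope ring_scope.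
Local Open Scope complex_scope.

Section LinearAlgebra.
Variable K : fieldType.

Definition lspan (U : lmodType K) (S : set U) : set U :=
  [set u | exists (n : nat) (a : 'I_n -> K) (s : 'I_n -> U),
     (forall i, S (s i)) /\ u = \sum_i a i *: s i].

Definition is_basis (U : lmodType K) (n : nat) (e : 'I_n -> U) : Prop :=
  (forall a : 'I_n -> K, \sum_i a i *: e i = 0 -> forall i, a i = 0) /\
  lspan (range e) = [set: U].

Definition is_tensor_product (U V T : lmodType K) (t : {bilinear U -> V -> T})
    : Prop :=
  forall (X : lmodType K) (f : {bilinear U -> V -> X}),
    exists2 g : {linear T -> X},
      (forall u v, g (t u v) = f u v) &
      (forall h : {linear T -> X}, (forall u v, h (t u v) = f u v) -> h =1 g).

(* For subspaces A of U and B of V: A tensor B as a subspace of U tensor V. *)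
Definition subtensor (U V T : lmodType K) (t : {bilinear U -> V -> T})
    (A : set U) (B : set V) : set T :=
  lspan [set t u v | u in A & v in B].

End LinearAlgebra.

Section WeakFunctions.
Variable R : realType.

(* The complex numbers; the regular module R[i]^o carries the topology. *)
Local Notation C := (R[i]^o).

Definition fraction (N : nat) : set C :=
  [set z | exists j : int, z = j%:~R / N%:R].

Definition at_most_simple_pole (w : C -> C) (p : C) : Prop :=
  exists g : C -> C, (\forall z \near p, derivable g z 1) /\
    (\forall z \near p^', (z - p) * w z = g z).

Definition rapidly_decreasing (w : C -> C) : Prop :=
  forall A : R, 0 < A -> exists c Y : R, forall x y : R,
    Y <= `|y| -> `|w (x +i* y)| <= (c * `|y| `^ (- A))%:C.

Definition weak_function (N : nat) (w : C -> C) : Prop :=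
  [/\ forall z, w (z + 1) = w z,
      forall z, ~ fraction N z -> derivable w z 1,
      forall p, fraction N p -> at_most_simple_pole w p &
      rapidly_decreasing w].

(* W_N^0.  Meromorphic functions being total here, a weak function with a
   removable singularity at 0 is represented by its holomorphic restriction to
   the complement of (1/N)Z \ Z, with the singularities at Z filled in,
   extended by the conventional value 0 on (1/N)Z \ Z.  This convention is
   compatible with the pointwise vector space operations. *)
Definition weak0 (N : nat) : set (C -> C) :=
  [set w | [/\ weak_function N w, derivable w 0 1 &
      forall z, fraction N z -> ~ fraction 1 z -> w z = 0]].

Section Closed.
Variable N : nat.

Lemma derivable_lin (a : R[i]) (u v : C -> C) (z : C) :
  derivable u z 1 -> derivable v z 1 -> derivable (a *: u + v) z 1.
Proof. by move=> du dv; exact: (derivableD (derivableZ du) dv). Qed.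

Lemma at_most_simple_pole0 p : at_most_simple_pole 0 p.
Proof.
exists 0; split; first by near=> z; exact: derivable_cst.
by near=> z; rewrite mulr0.
Unshelve. all: by end_near. Qed.

Lemma at_most_simple_pole_lin (a : R[i]) (u v : C -> C) p :
  at_most_simple_pole u p -> at_most_simple_pole v p ->
  at_most_simple_pole (a *: u + v) p.
Proof.
move=> [g [dg gE]] [h [dh hE]]; exists (a *: g + h); split.
  by apply: filterS2 dg dh => z; exact: derivable_lin.
apply: filterS2 gE hE => z gE hE.
rewrite -[(a *: g + h) z]/(a * g z + h z) -[(a *: u + v) z]/(a * u z + v z).
by rewrite mulrDr hE mulrCA gE.
Qed.

Lemma rapidly_decreasing_lin (a : R[i]) (u v : C -> C) :
  rapidly_decreasing u -> rapidly_decreasing v ->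
  rapidly_decreasing (a *: u + v).
Proof.
move=> du dv A A0; have [c [Y cY]] := du A A0; have [d [Z dZ]] := dv A A0.
have [b bE] : exists b : R, `|a| = b%:C.
  by exists (complex.Re `|a|); rewrite RRe_real // normr_real.
exists (b * c + d), (Num.max Y Z) => x y; rewrite ge_max => /andP[hY hZ].
rewrite mulrDl rmorphD /= -mulrA (rmorphM _ b) /= -bE.
apply: le_trans (ler_normD _ _) _; apply: lerD; last exact: dZ.
by rewrite normrM ler_wpM2l // cY.
Qed.

Lemma weak00 : weak0 N 0.
Proof.
split; [|exact: derivable_cst|by []].
split; [by []|move=> z _|move=> p _|move=> A _].
- exact: derivable_cst.
- exact: at_most_simple_pole0.
- by exists 0, 0 => x y _; rewrite normr0 mul0r.
Qed.

Lemma weak0_lin (a : R[i]) (u v : C -> C) :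
  weak0 N u -> weak0 N v -> weak0 N (a *: u + v).
Proof.
move=> [[u1 ud up uy] u0 uz] [[v1 vd vp vy] v0 vz].
have E z : (a *: u + v) z = a * u z + v z by [].
split; [split| |].
- by move=> z; rewrite !E u1 v1.
- by move=> z hz; apply: derivable_lin; [exact: ud|exact: vd].
- by move=> p hp; apply: at_most_simple_pole_lin; [exact: up|exact: vp].
- exact: rapidly_decreasing_lin.
- exact: derivable_lin.
- by move=> z hN h1; rewrite E uz // vz // mulr0 addr0.
Qed.

Lemma weak0_submod : GRing.subsemimod_closed (mem (weak0 N) : {pred C -> C}).
Proof.
split; first split.
- by rewrite inE; exact: weak00.
- move=> u v; rewrite !inE => hu hv; rewrite -[u]scale1r.
  exact: weak0_lin.
- move=> a u; rewrite !inE => hu; rewrite -[_ *: _]addr0.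
  exact: (weak0_lin _ hu weak00).
Qed.
End Closed.

Record weak0Type (N : nat) :=
  Weak0 { weak0_fun :> C -> C; weak0_funP : weak0_fun \in weak0 N }.

HB.instance Definition _ N := [isSub for @weak0_fun N].
HB.instance Definition _ N := [Choice of weak0Type N by <:].
HB.instance Definition _ N :=
  GRing.SubChoice_isSubLmodule.Build R[i] (C -> C) (mem (weak0 N)) (weak0Type N)
    (weak0_submod N).

Definition weak0_parity (N : nat) (s : R[i]) : set (weak0Type N) :=
  [set w | forall z : C, w (- z) = s * w z].

Definition weak0_ord_ge (N l : nat) : set (weak0Type N) :=
  [set w | exists g : C -> C, (\forall z \near (0 : C), derivable g z 1) /\
     (\forall z \near (0 : C), w z = z ^+ l * g z)].

Definition is_adapted_basis (N : nat) (a : 'I_(N - 2) -> weak0Type N) : Prop :=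
  [/\ is_basis a,
      forall j, exists k : R, \forall z \near (0 : C),
        `|a j z - z ^+ j| <= k%:C * `|z| ^+ (N - 2) &
      forall j (z : C), a j (- z) = (-1) ^+ j * a j z].

Definition tensor_space (M N : nat) (T : lmodType R[i])
    (t : {bilinear weak0Type M -> weak0Type N -> T}) (l1 l2 : nat) : set T :=
  subtensor t (@weak0_ord_ge M l1) (@weak0_ord_ge N l2).

(* Functions of (z, tau) are functions of a pair p with p.1 = z, p.2 = tau. *)
Definition jacobi_product (M N : nat) (w : weak0Type M) (eta : weak0Type N)
    (p : C * C) : C := eta p.1 * w (p.1 * p.2).

Definition J0 (M N : nat) : set (C * C -> C) :=
  lspan [set jacobi_product w eta | w in [set: weak0Type M]
                                  & eta in [set: weak0Type N]].

(* Locally a quotient of holomorphic functions, the germ of the denominator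
   being nonzero; values on the zero set of the denominator are irrelevant. *)
Definition meromorphic2 (G : C * C -> C) : Prop :=
  forall p : C * C, exists f g : C * C -> C,
    [/\ \forall q \near p, differentiable f q /\ differentiable g q,
        ~ (\forall q \near p, g q = 0) &
        \forall q \near p, g q != 0 -> G q = f q / g q].

Definition is_expansion (G : C * C -> C) (P : nat -> {poly R[i]}) : Prop :=
  forall tau : C, \forall p \near ((0, tau) : C * C),
    series (fun j => (P j).[p.2] * p.1 ^+ j : C) @ \oo --> G p.

Definition edeg (P : {poly R[i]}) : \bar R :=
  if P == 0 then -oo%E else ((size P).-1%:R)%:E.

(* tau ^ j * P (1 / tau), for P of degree at most j. *)
Definition poly_flip (j : nat) (P : {poly R[i]}) : {poly R[i]} :=
  \poly_(i < j.+1) P`_(j - i).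

Definition codeg (j : nat) (P : {poly R[i]}) : \bar R :=
  ((j%:R)%:E - edeg P)%E.

Definition Czt (nu mu : nat) : set (C * C -> C) :=
  [set G | meromorphic2 G /\ exists2 P : nat -> {poly R[i]}, is_expansion G P &
     forall j, [/\ (edeg (P j) <= (j%:R)%:E)%E,
                   ((mu%:R)%:E <= codeg j (P j))%E &
                   ((nu%:R)%:E <= codeg j (poly_flip j (P j)))%E]].

(* The infima below are minima of sets of naturals (or +oo). *)
Definition ord_fun (G : C * C -> C) : \bar R * \bar R :=
  let P := xget (fun=> 0) [set P | is_expansion G P] in
  (ereal_inf (range (fun j => codeg j (poly_flip j (P j)))),
   ereal_inf (range (fun j => codeg j (P j)))).

Definition ord_tensor (M N : nat) (T : lmodType R[i])
    (t : {bilinear weak0Type M -> weak0Type N -> T})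
    (a : 'I_(M - 2) -> weak0Type M) (b : 'I_(N - 2) -> weak0Type N) (F : T)
    : \bar R * \bar R :=
  let c := xget 0 [set c : 'M[R[i]]_(M - 2, N - 2) |
                    F = \sum_m \sum_n c m n *: t (a m) (b n)] in
  (ereal_inf [set ((m : nat)%:R)%:E | m in [set m | exists n, c m n != 0]],
   ereal_inf [set ((n : nat)%:R)%:E | n in [set n | exists m, c m n != 0]]).

End WeakFunctions.

(* Main.v *)
Require Import Defs.
From HB Require Import structures.
From mathcomp Require Import all_boot all_order all_algebra.
From mathcomp Require Import sesquilinear.
From mathcomp Require Import all_classical all_reals all_analysis.
From mathcomp.real_closed Require Import complex.
From mathcomp Require Import ring lra zify.

Set Implicit Arguments.
Unset Strict Implicit.
Unset Printing Implicit Defensive.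

Import Order.TTheory GRing.Theory Num.Theory.
Import numFieldNormedType.Exports.

Local Open Scope classical_set_scope.
Local Open Scope ring_scope.
Local Open Scope complex_scope.


(**
By Goursat's theorem and Cauchy's formula the basis functions have Taylor
series at 0.  If F = sum c_mn alpha_m (x) alpha_n and A_m, B_n are the Taylor
coefficients of the basis functions of W_M^0 and W_N^0, the function attached to F is
sum_(i, k) g_ik (z tau)^i z^k with g_ik = sum_(m, n) c_mn A_mi B_nk, so that
its expansion is P_j = sum_(i + k = j) g_ik tau^i.  Since A_mi is the Kronecker
symbol for i < M - 2 and B_nk is so for k < N - 2, we have g_ik = c_ik for
these i, k, while g_ik <> 0 forces some c_mn <> 0 with m <= i and n <= k.
Expansions being unique, the c_mn are recovered from the function; the order of
the function and the conditions on deg P_j are conditions on the support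
of g, which by the above amount to the same conditions on the support of c.
*)

(** * Norm and path integrals in the complex plane *)

(** Holomorphy is given only as the existence of a complex derivative near a point. Nothing is known
    about the continuity of that derivative, so the Taylor series have to be built up from Goursat's
    bisection argument. Rectangles are used as contours because their integrals reduce to real
    integrals over segments and can be cut into pieces, and because the residue integral of 1 / (z -
    p) over a square is an arctangent. The universal property of the tensor product supplies the
    map. That the tensors alpha_m (x) beta_n have well-determined coefficients is then read off from
    their images, through the uniqueness of expansions. For meromorphy the obstacle is that the
    poles of w(z tau) lie along curves. Since all poles are at most simple, one explicit denominator
    of two factors works near each point, for all generators of [J0] at once. *)

Section ComplexNorm.
Variable R : realType.
Implicit Types (z w : R[i]) (x y : R).

Local Notation normc := (@Normc.normc R).

Lemma normc_sqrt z : normc z = Num.sqrt (complex.Re z ^+ 2 + complex.Im z ^+ 2).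
Proof. by case: z. Qed.

Lemma norm_normc z : `|z| = (normc z)%:C.
Proof. by case: z. Qed.

Lemma normc_ge0 z : 0 <= normc z.
Proof. by rewrite normc_sqrt sqrtr_ge0. Qed.

Lemma normcD z w : normc (z + w) <= normc z + normc w.
Proof. by rewrite -lecR rmorphD /= -!norm_normc ler_normD. Qed.

Lemma normcN z : normc (- z) = normc z.
Proof. by case: z => a b; rewrite /= !sqrrN. Qed.

Lemma normcB z w : normc (z - w) = normc (w - z).
Proof. by rewrite -normcN opprB. Qed.

Lemma normcM z w : normc (z * w) = normc z * normc w.
Proof. exact: Normc.normcM. Qed.

Lemma normc0 : normc 0 = 0.
Proof. exact: Normc.normc0. Qed.

Lemma normc1 : normc 1 = 1.
Proof. exact: Normc.normc1. Qed.

Lemma normcX z n : normc (z ^+ n) = normc z ^+ n.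
Proof. by elim: n => [|n IH]; rewrite ?expr0 ?normc1 // !exprS normcM IH. Qed.

Lemma normc_eq0 z : (normc z == 0) = (z == 0).
Proof.
apply/eqP/eqP => [/Normc.eq0_normc //|->]; exact: normc0.
Qed.

Lemma normc_gt0 z : (0 < normc z) = (z != 0).
Proof. by rewrite lt_def normc_ge0 andbT normc_eq0. Qed.

Lemma normcV z : normc z^-1 = (normc z)^-1.
Proof.
have [->|z0] := eqVneq z 0; first by rewrite invr0 normc0 invr0.
have nz : normc z != 0 by rewrite normc_eq0.
by apply: (mulfI nz); rewrite -normcM !mulfV // normc1.
Qed.

Lemma normc_real x : normc x%:C = `|x|.
Proof. by rewrite /= expr0n /= addr0 sqrtr_sqr. Qed.

Lemma normci : normc 'i = 1.
Proof. by rewrite /= expr0n /= add0r expr1n sqrtr1. Qed.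

Lemma normc_sum (I : Type) (s : seq I) (P : pred I) (F : I -> R[i]) :
  normc (\sum_(i <- s | P i) F i) <= \sum_(i <- s | P i) normc (F i).
Proof.
elim/big_rec2: _ => [|i y1 y2 _ h]; first by rewrite normc0.
by rewrite (le_trans (normcD _ _)) // lerD2l.
Qed.

Lemma normc_distD (z w u : R[i]) : normc (z - u) <= normc (z - w) + normc (w - u).
Proof. by rewrite -[z - u](subrKA w) normcD. Qed.

Lemma Re_le_normc z : `|complex.Re z| <= normc z.
Proof. by rewrite -lecR -norm_normc normc_ge_Re. Qed.

Lemma Im_le_normc z : `|complex.Im z| <= normc z.
Proof.
rewrite normc_sqrt -[`|_|]sqrtr_sqr; apply: ler_wsqrtr.
by rewrite lerDr sqr_ge0.
Qed.

Lemma normc_le_ReIm z : normc z <= `|complex.Re z| + `|complex.Im z|.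
Proof.
rewrite {1}[z]complexE (le_trans (normcD _ _)) // normcM normci mul1r.
by rewrite !normc_real.
Qed.

End ComplexNorm.

Section ComplexIntegral.
Variable R : realType.
Implicit Types (f g : R -> R) (psi phi : R -> R[i]) (a b c x : R).

Local Notation normc := (@Normc.normc R).
Local Notation mu := (@lebesgue_measure R).

(** The point [y] is not confined to [a, b]: continuity is two-sided at the end points too, as it is
    for the restriction of a function continuous in the plane. *)
Definition path_continuous psi a b :=
  forall x, a <= x <= b -> forall e, 0 < e ->
  exists2 d, 0 < d & forall y, `|y - x| < d -> normc (psi y - psi x) < e.

Definition path_int psi a b : R[i] :=
  (\int[mu]_(x in `[a, b]) complex.Re (psi x))%R +i*
  (\int[mu]_(x in `[a, b]) complex.Im (psi x))%R.

Lemma path_integrable psi a b : path_continuous psi a b ->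
  mu.-integrable `[a, b] (EFin \o (fun x => complex.Re (psi x))) /\
  mu.-integrable `[a, b] (EFin \o (fun x => complex.Im (psi x))).
Proof.
move=> cpsi.
(* [p] stands for the real or the imaginary part; both are additive and 1-Lipschitz. *)
have H (p : R[i] -> R) : (forall z w, p z - p w = p (z - w)) ->
    (forall z, `|p z| <= normc z) ->
    mu.-integrable `[a, b] (EFin \o (fun x => p (psi x))).
  move=> pB pn; apply: (@continuous_compact_integrable R); first exact: segment_compact.
  apply: continuous_in_subspaceT => x; rewrite inE /= in_itv /= => xab.
  apply/cvgrPdist_lt => e e0; have [d d0 dP] := cpsi x xab e e0.
  apply/nbhs_ballP; exists d => // y /= yx.
  by rewrite pB (le_lt_trans (pn _)) // normcB dP // distrC.
split; apply: H => [z w|z].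
- by case: z w => [? ?] [].
- exact: Re_le_normc.
- by case: z w => [? ?] [].
- exact: Im_le_normc.
Qed.

Lemma eq_path_int psi phi a b :
  (forall x, a <= x <= b -> psi x = phi x) -> path_int psi a b = path_int phi a b.
Proof.
move=> E; congr (_ +i* _); apply: eq_Rintegral => x; rewrite inE /= in_itv /= => h;
  by rewrite E.
Qed.

Lemma path_continuous_lin (u : R[i]) psi phi a b :
  path_continuous psi a b -> path_continuous phi a b ->
  path_continuous (fun x => u * psi x + phi x) a b.
Proof.
move=> h1 h2 x xab e e0.
have n1 : 0 < normc u + 1 by rewrite ltr_wpDl ?normc_ge0.
have [|d1 d10 D1] := h1 x xab (e / 2 / (normc u + 1)); first by rewrite !divr_gt0.
have [|d2 d20 D2] := h2 x xab (e / 2); first by rewrite divr_gt0.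
exists (Num.min d1 d2) => [|y]; first by rewrite lt_min d10.
rewrite lt_min => /andP[/D1 {}D1 /D2 {}D2].
have -> : u * psi y + phi y - (u * psi x + phi x) =
  u * (psi y - psi x) + (phi y - phi x) by ring.
apply: (le_lt_trans (normcD _ _)); rewrite [e]splitr; apply: ler_ltD D2.
rewrite normcM.
apply: (@le_trans _ _ ((normc u + 1) * (e / 2 / (normc u + 1)))).
  by apply: ler_pM; rewrite ?normc_ge0 ?lerDl // ltW.
by rewrite mulrC divfK // gt_eqF.
Qed.

Lemma path_intD_lin (u : R[i]) psi phi a b :
  path_continuous psi a b -> path_continuous phi a b ->
  path_int (fun x => u * psi x + phi x) a b = u * path_int psi a b + path_int phi a b.
Proof.
move=> /path_integrable[i1 i2] /path_integrable[i3 i4].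
have sc (r : R) f : mu.-integrable `[a, b] (EFin \o f) ->
    mu.-integrable `[a, b] (EFin \o (fun x => r * f x)).
  by move=> h; apply: (eq_integrable _ _ _ _ (integrableZl _ r h)).
have add f g : mu.-integrable `[a, b] (EFin \o f) -> mu.-integrable `[a, b] (EFin \o g) ->
    mu.-integrable `[a, b] (EFin \o (fun x => f x + g x)).
  by move=> h k; apply: (eq_integrable _ _ _ _ (integrableD _ h k)).
case: u => p q; rewrite /path_int.
(* A complex scalar mixes the two parts of [psi], so each part of the result needs the integrability
   of both. *)
have -> : (\int[mu]_(x in `[a, b]) complex.Re ((p +i* q) * psi x + phi x))%R =
   (\int[mu]_(x in `[a, b]) ((p * complex.Re (psi x) + (- q) * complex.Im (psi x)) +
     complex.Re (phi x)))%R.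
  by apply: eq_Rintegral => x _; case: (psi x) (phi x) => [? ?] [? ?] /=; rewrite mulNr.
have -> : (\int[mu]_(x in `[a, b]) complex.Im ((p +i* q) * psi x + phi x))%R =
   (\int[mu]_(x in `[a, b]) ((p * complex.Im (psi x) + q * complex.Re (psi x)) +
     complex.Im (phi x)))%R.
  by apply: eq_Rintegral => x _; case: (psi x) (phi x) => [? ?] [? ?] /=.
rewrite !RintegralD ?RintegralZl //; try by [apply: sc|apply: add; apply: sc].
rewrite /= ; apply/eqP; rewrite eq_complex /=; apply/andP; split; apply/eqP; ring.
Qed.

Lemma Rintegral_segment_cst r a b : a <= b ->
  (\int[mu]_(x in `[a, b]) r)%R = r * (b - a).
Proof.
move=> ab; rewrite Rintegral_cst ?measurable_itv //; congr (_ * _).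
transitivity (fine (lebesgue_measure (`[a, b]%classic : set R))) => //.
rewrite lebesgue_measure_itv /= lte_fin; case: ltP => //= ba.
by have -> : a = b; [apply/eqP; rewrite eq_le ab|rewrite subrr].
Qed.

Lemma path_int_cst (u : R[i]) a b : a <= b -> path_int (fun=> u) a b = u * (b - a)%:C.
Proof.
move=> ab; rewrite /path_int !Rintegral_segment_cst //.
case: u => p q /=; apply/eqP; rewrite eq_complex /=.
by apply/andP; split; apply/eqP; ring.
Qed.

Lemma path_int_chasles psi a c b : a <= c <= b -> path_continuous psi a b ->
  path_int psi a b = path_int psi a c + path_int psi c b.
Proof.
move=> /andP[ac cb] /path_integrable[i1 i2].
have H f : mu.-integrable `[a, b] (EFin \o f) ->
   (\int[mu]_(x in `[a, b]) f x = \int[mu]_(x in `[a, c]) f x + \int[mu]_(x in `[c, b])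
     f x)%R.
  move=> fi; have := @Rintegral_itvB R f (BLeft a) (BRight b) c fi.
  rewrite !bnd_simp => /(_ ac cb) h.
  rewrite -[LHS](subrK (\int[mu]_(x in `[a, c]) f x)) h addrC; congr (_ + _).
  apply: Rintegral_itv_obnd_cbnd; apply: integrableS fi => //.
  by apply: subset_itvr; rewrite bnd_simp.
by rewrite /path_int !H.
Qed.

(* The real and imaginary parts are bounded separately, whence the factor 2. *)
Lemma path_int_le psi a b (m : R) : a <= b -> path_continuous psi a b ->
  (forall x, a <= x <= b -> normc (psi x) <= m) ->
  normc (path_int psi a b) <= 2 * m * (b - a).
Proof.
move=> ab /path_integrable[i1 i2] hm.
have H (p : R[i] -> R) : (forall z, `|p z| <= normc z) ->
   mu.-integrable `[a, b] (EFin \o (fun x => p (psi x))) ->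
   `|\int[mu]_(x in `[a, b]) p (psi x)| <= m * (b - a).
  move=> pn ip; apply: (le_trans (le_normr_Rintegral _ ip)); first exact: measurable_itv.
  rewrite -(Rintegral_segment_cst m ab).
  apply: le_Rintegral; first exact: measurable_itv.
  - by have := integrable_norm ip; apply: eq_integrable.
  - apply: (@continuous_compact_integrable R); first exact: segment_compact.
    by apply: continuous_subspaceT => x; exact: cst_continuous.
  - by move=> x; rewrite /= in_itv /= => h; rewrite (le_trans (pn _)) // hm.
rewrite (le_trans (normc_le_ReIm _)) // -mulrA mulr_natl mulr2n lerD //=.
  by apply: H => //; exact: Re_le_normc.
by apply: H => //; exact: Im_le_normc.
Qed.

End ComplexIntegral.

(** * Complex differentiability in epsilon-delta form *)

Section ComplexDerivative.
Variable R : realType.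

Local Notation C := (R[i]^o).
Local Notation normc := (@Normc.normc R).
Implicit Types (f g : C -> C) (z w : R[i]).

(** The norm of [R[i]] takes its values in [R[i]], so radii of balls are complex; positive ones are
    real because the order compares only numbers with equal imaginary parts. *)
Lemma gt0_complexP (e : R[i]) : 0 < e -> exists2 d : R, 0 < d & e = d%:C.
Proof.
move=> e0; exists (complex.Re e); last by rewrite RRe_real // realE ltW.
by case: e e0 => a b; rewrite ltcE /= => /andP[].
Qed.

Lemma nbhs_normcP (P : set C) (z : C) :
  (\forall w \near z, P w) <-> exists2 d : R, 0 < d & forall w, normc (w - z) < d -> P w.
Proof.
split=> [/nbhs_ballP[e /= /gt0_complexP[d d0 ->] dP]|[d d0 dP]].
  exists d => // w wd; apply: dP; rewrite /ball /= distrC; by rewrite norm_normc ltcR.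
apply/nbhs_ballP; exists d%:C; first by rewrite /= ltcR.
by move=> w; rewrite /ball /= distrC norm_normc ltcR; exact: dP.
Qed.

Lemma dnbhs_normcP (P : set C) (z : C) :
  (\forall w \near z^', P w) <->
  exists2 d : R, 0 < d & forall w, normc (w - z) < d -> w != z -> P w.
Proof.
rewrite -(nbhs_normcP (fun w => w != z -> P w)).
by split; rewrite near_withinE.
Qed.

(** The difference quotient with denominators cleared, so that [w = z] is allowed and the affine
    approximation appears directly. *)
Definition has_cderiv f z (d : R[i]) := forall e : R, 0 < e ->
  exists2 r : R, 0 < r & forall w, normc (w - z) < r ->
    normc (f w - f z - d * (w - z)) <= e * normc (w - z).

Lemma has_cderivP f z : derivable f z 1 <-> exists d, has_cderiv f z d.
Proof.
split=> [|[d df]].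
  move=> /cvgrPdist_lt df; exists ('D_1 f z) => e e0.
  have e0C : 0 < e%:C by rewrite ltcR.
  have /dnbhs_normcP[r r0 H] := df _ e0C.
  exists r => // w wr; have [->|wz] := eqVneq w z.
    by rewrite !subrr mulr0 subr0 normc0 mulr0.
  have := H (w - z); rewrite subr0 subr_eq0 => /(_ wr wz); rewrite norm_normc ltcR.
  rewrite /= /GRing.scale /= mulr1 subrK => h.
  have -> : f w - f z - 'D_1 f z * (w - z) =
    - ('D_1 f z - (w - z)^-1 * (f w - f z)) * (w - z).
    by field; rewrite subr_eq0.
  by rewrite normcM normcN ler_wpM2r ?normc_ge0 // ltW.
apply/cvg_ex; exists d; apply/cvgrPdist_le => e' /gt0_complexP[e e0 ->].
have [r r0 H] := df e e0.
apply/dnbhs_normcP; exists r => // h; rewrite subr0 => hr h0.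
have := H (h + z); rewrite addrK => /(_ hr) {}H.
rewrite norm_normc lecR /= /GRing.scale /= mulr1.
have -> : d - h^-1 * (f (h + z) - f z) = - (h^-1 * (f (h + z) - f z - d * h)).
  by field.
by rewrite normcN normcM normcV mulrC ler_pdivrMr // normc_gt0.
Qed.

Definition ccontinuous_at f z := forall e : R, 0 < e ->
  exists2 d : R, 0 < d & forall w, normc (w - z) < d -> normc (f w - f z) < e.

Lemma derivable_ccontinuous f z : derivable f z 1 -> ccontinuous_at f z.
Proof.
move=> /has_cderivP[d /(_ 1 ltr01)[r r0 H]] e e0.
(* Error at most 1 times |w - z| in the affine approximation: [normc d + 1] is a Lipschitz constant
   at [z]. *)
have k0 : 0 < normc d + 1 by rewrite ltr_wpDl ?normc_ge0.
exists (Num.min r (e / (normc d + 1))) => [|w]; first by rewrite lt_min r0 divr_gt0.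
rewrite lt_min ltr_pdivlMr // => /andP[/H {}H]; apply: le_lt_trans.
rewrite -[f w - f z](subrK (d * (w - z))) (le_trans (normcD _ _)) //.
by rewrite [leRHS]mulrDr mulr1 addrC normcM mulrC lerD2l; rewrite mul1r in H.
Qed.

Lemma ccontinuous_lin (u : R[i]) f g z : ccontinuous_at f z -> ccontinuous_at g z ->
  ccontinuous_at (fun w => u * f w + g w) z.
Proof.
move=> h1 h2 e e0.
have n1 : 0 < normc u + 1 by rewrite ltr_wpDl ?normc_ge0.
have [|d1 d10 D1] := h1 (e / 2 / (normc u + 1)); first by rewrite !divr_gt0.
have [|d2 d20 D2] := h2 (e / 2); first by rewrite divr_gt0.
exists (Num.min d1 d2) => [|y]; first by rewrite lt_min d10.
rewrite lt_min => /andP[/D1 {}D1 /D2 {}D2].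
have -> : u * f y + g y - (u * f z + g z) =
  u * (f y - f z) + (g y - g z) by ring.
apply: (le_lt_trans (normcD _ _)); rewrite [e]splitr; apply: ler_ltD D2.
rewrite normcM.
apply: (@le_trans _ _ ((normc u + 1) * (e / 2 / (normc u + 1)))).
  by apply: ler_pM; rewrite ?normc_ge0 ?lerDl // ltW.
by rewrite mulrC divfK // gt_eqF.
Qed.

Lemma path_continuous_hor f a b y :
  (forall x, a <= x <= b -> ccontinuous_at f (x +i* y)) ->
  path_continuous (fun x => f (x +i* y)) a b.
Proof.
move=> H x /H + e e0 => /(_ e e0)[d d0 D]; exists d => // x' xx'.
by apply: D; rewrite /= subrr expr0n addr0 sqrtr_sqr.
Qed.

Lemma path_continuous_ver f a b x :
  (forall y, a <= y <= b -> ccontinuous_at f (x +i* y)) ->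
  path_continuous (fun y => f (x +i* y)) a b.
Proof.
move=> H y /H + e e0 => /(_ e e0)[d d0 D]; exists d => // y' yy'.
by apply: D; rewrite /= subrr expr0n add0r sqrtr_sqr.
Qed.

End ComplexDerivative.

(** * Contour integrals over rectangles *)

Section RectangleIntegral.
Variable R : realType.

Local Notation C := (R[i]^o).
Local Notation normc := (@Normc.normc R).
Implicit Types (f g : C -> C) (x y : R).

(** The counterclockwise contour integral of f(z) dz, opposite sides being merged into one
    integrand; ['i] comes from dz = i dy on the vertical sides. *)
Definition rect_int f x0 x1 y0 y1 : R[i] :=
  path_int (fun x => f (x +i* y0) - f (x +i* y1)) x0 x1 +
  'i * path_int (fun y => f (x1 +i* y) - f (x0 +i* y)) y0 y1.

Definition continuous_on_border f x0 x1 y0 y1 :=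
  (forall x, x0 <= x <= x1 ->
     ccontinuous_at f (x +i* y0) /\ ccontinuous_at f (x +i* y1)) /\
  (forall y, y0 <= y <= y1 ->
     ccontinuous_at f (x0 +i* y) /\ ccontinuous_at f (x1 +i* y)).

Lemma path_continuousB (psi phi : R -> R[i]) a b :
  path_continuous psi a b -> path_continuous phi a b ->
  path_continuous (fun x => psi x - phi x) a b.
Proof.
move=> h1 h2; have := path_continuous_lin (-1) h2 h1.
by congr path_continuous; apply/funext => x; rewrite mulN1r addrC.
Qed.

Lemma path_intB (psi phi : R -> R[i]) a b :
  path_continuous psi a b -> path_continuous phi a b ->
  path_int (fun x => psi x - phi x) a b = path_int psi a b - path_int phi a b.
Proof.
move=> h1 h2; have := path_intD_lin (-1) h2 h1.
rewrite mulN1r addrC => <-; apply: eq_path_int => x _.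
by rewrite mulN1r addrC.
Qed.

Lemma border_hor f x0 x1 y0 y1 : continuous_on_border f x0 x1 y0 y1 ->
  path_continuous (fun x => f (x +i* y0)) x0 x1 /\
  path_continuous (fun x => f (x +i* y1)) x0 x1.
Proof.
by move=> [h _]; split; apply: path_continuous_hor => x /h[].
Qed.

Lemma border_ver f x0 x1 y0 y1 : continuous_on_border f x0 x1 y0 y1 ->
  path_continuous (fun y => f (x0 +i* y)) y0 y1 /\
  path_continuous (fun y => f (x1 +i* y)) y0 y1.
Proof.
by move=> [_ h]; split; apply: path_continuous_ver => x /h[].
Qed.

(** The common side is run through once in each direction, so its contributions cancel. *)
Lemma rect_int_cut_ver f x0 c x1 y0 y1 : x0 <= c <= x1 ->
  continuous_on_border f x0 c y0 y1 -> continuous_on_border f c x1 y0 y1 ->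
  rect_int f x0 x1 y0 y1 = rect_int f x0 c y0 y1 + rect_int f c x1 y0 y1.
Proof.
move=> xcx b1 b2; have cx : continuous_on_border f x0 x1 y0 y1.
  split=> [x /andP[h1 h2]|y h].
    have [xc|/ltW cx] := leP x c; first by apply: b1.1; rewrite h1.
    by apply: b2.1; rewrite cx.
  by split; [apply: (b1.2 y h).1|apply: (b2.2 y h).2].
have [v1 v2] := border_ver b1; have [v3 v4] := border_ver b2.
have [h1 h2] := border_hor cx.
rewrite /rect_int (path_int_chasles xcx); last exact: path_continuousB.
rewrite !(path_intB v2 v1, path_intB v4 v3, path_intB v4 v1).
by ring.
Qed.

Lemma rect_int_cut_hor f x0 x1 y0 c y1 : y0 <= c <= y1 ->
  continuous_on_border f x0 x1 y0 c -> continuous_on_border f x0 x1 c y1 ->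
  rect_int f x0 x1 y0 y1 = rect_int f x0 x1 y0 c + rect_int f x0 x1 c y1.
Proof.
move=> ycy b1 b2; have cx : continuous_on_border f x0 x1 y0 y1.
  split=> [x h|y /andP[h1 h2]].
    by split; [apply: (b1.1 x h).1|apply: (b2.1 x h).2].
  have [yc|/ltW cy] := leP y c; first by apply: b1.2; rewrite h1.
  by apply: b2.2; rewrite cy.
have [v1 v2] := border_hor b1; have [v3 v4] := border_hor b2.
have [h1 h2] := border_ver cx.
rewrite /rect_int (path_int_chasles ycy); last exact: path_continuousB.
rewrite !(path_intB v1 v2, path_intB v3 v4, path_intB v1 v4).
by ring.
Qed.

Lemma border_lin (u : R[i]) f g x0 x1 y0 y1 :
  continuous_on_border f x0 x1 y0 y1 -> continuous_on_border g x0 x1 y0 y1 ->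
  continuous_on_border (fun z => u * f z + g z) x0 x1 y0 y1.
Proof.
move=> [h1 h2] [h3 h4]; split=> t ht.
  by have [a b] := h1 t ht; have [c d] := h3 t ht; split; exact: ccontinuous_lin.
by have [a b] := h2 t ht; have [c d] := h4 t ht; split; exact: ccontinuous_lin.
Qed.

Lemma rect_int_lin (u : R[i]) f g x0 x1 y0 y1 :
  continuous_on_border f x0 x1 y0 y1 -> continuous_on_border g x0 x1 y0 y1 ->
  rect_int (fun z => u * f z + g z) x0 x1 y0 y1 =
  u * rect_int f x0 x1 y0 y1 + rect_int g x0 x1 y0 y1.
Proof.
move=> bf bg; have [h1 h2] := border_hor bf; have [h3 h4] := border_hor bg.
have [v1 v2] := border_ver bf; have [v3 v4] := border_ver bg.
rewrite /rect_int.
have E (p q r s : R -> R[i]) a b : path_continuous p a b -> path_continuous q a b ->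
    path_continuous r a b -> path_continuous s a b ->
    path_int (fun t => u * p t + q t - (u * r t + s t)) a b =
    u * path_int (fun t => p t - r t) a b + path_int (fun t => q t - s t) a b.
  move=> cp cq cr cs; rewrite -path_intD_lin; try exact: path_continuousB.
  by apply: eq_path_int => t _; ring.
by rewrite (E _ _ _ _ _ _ h1 h3 h2 h4) (E _ _ _ _ _ _ v2 v4 v1 v3); ring.
Qed.

Lemma eq_rect_int f g x0 x1 y0 y1 :
  (forall x, x0 <= x <= x1 -> f (x +i* y0) = g (x +i* y0) /\ f (x +i* y1) = g (x +i* y1)) ->
  (forall y, y0 <= y <= y1 -> f (x0 +i* y) = g (x0 +i* y) /\ f (x1 +i* y) = g (x1 +i* y)) ->
  rect_int f x0 x1 y0 y1 = rect_int g x0 x1 y0 y1.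
Proof.
move=> h1 h2; congr (_ + _ * _); apply: eq_path_int => t.
  by move=> /h1[-> ->].
by move=> /h2[-> ->].
Qed.

Lemma rect_int_le f x0 x1 y0 y1 (m : R) : x0 <= x1 -> y0 <= y1 ->
  continuous_on_border f x0 x1 y0 y1 ->
  (forall x, x0 <= x <= x1 -> normc (f (x +i* y0)) <= m /\ normc (f (x +i* y1)) <= m) ->
  (forall y, y0 <= y <= y1 -> normc (f (x0 +i* y)) <= m /\ normc (f (x1 +i* y)) <= m) ->
  normc (rect_int f x0 x1 y0 y1) <= 4 * m * ((x1 - x0) + (y1 - y0)).
Proof.
move=> x01 y01 b h1 h2; have [p1 p2] := border_hor b; have [q1 q2] := border_ver b.
rewrite (le_trans (normcD _ _)) // normcM normci mul1r mulrDr.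
(* Each integrand is a difference of two values of norm at most [m]; the other factor 2 is that of
   [path_int_le]. *)
have -> : 4 * m = 2 * (m + m) by ring.
apply: lerD; apply: path_int_le => //; try exact: path_continuousB.
  by move=> t /h1[? ?]; rewrite (le_trans (normcD _ _)) // normcN lerD.
by move=> t /h2[? ?]; rewrite (le_trans (normcD _ _)) // normcN lerD.
Qed.

(** The values on opposite sides differ by a constant, and the two resulting products of the side
    lengths with [u * 'i] have opposite signs. *)
Lemma rect_int_affine (u v : R[i]) x0 x1 y0 y1 : x0 <= x1 -> y0 <= y1 ->
  rect_int (fun z => u * z + v) x0 x1 y0 y1 = 0.
Proof.
move=> x01 y01; rewrite /rect_int.
rewrite (@eq_path_int _ _ (fun=> u * 'i * (y0 - y1)%:C)); last first.
  move=> t _; case: u v => [p q] [r s]; apply/eqP; rewrite eq_complex /=.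
  by apply/andP; split; apply/eqP; ring.
rewrite (@eq_path_int _ (fun y => _ - _) (fun=> u * (x1 - x0)%:C)); last first.
  move=> t _; case: u v => [p q] [r s]; apply/eqP; rewrite eq_complex /=.
  by apply/andP; split; apply/eqP; ring.
rewrite !path_int_cst // !rmorphB /=; ring.
Qed.

End RectangleIntegral.

(** * Goursat's theorem and Cauchy's formula *)

Section Goursat.
Variable R : realType.

Local Notation C := (R[i]^o).
Local Notation normc := (@Normc.normc R).
Implicit Types (f g : C -> C) (x y : R).

(** Compactness as an induction principle: a rectangle violating [P] has a violating quarter, and
    the nested sequence so obtained shrinks to a point, where the local hypothesis contradicts it.
    The shape w by h is fixed, so a rectangle is its lower left corner and its scale [k]. *)
Lemma rectangle_bisection (w h : R) (P : R -> R -> R -> Prop) : 0 <= w -> 0 <= h ->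
  (forall x y k, 0 < k -> P x y (k / 2) -> P (x + w * (k / 2)) y (k / 2) ->
     P x (y + h * (k / 2)) (k / 2) ->
     P (x + w * (k / 2)) (y + h * (k / 2)) (k / 2) -> P x y k) ->
  (forall cx cy, exists2 d, 0 < d & forall x y k, 0 < k < d ->
     x <= cx <= x + w * k -> y <= cy <= y + h * k -> P x y k) ->
  forall x y k, 0 < k -> P x y k.
Proof.
move=> w0 h0 split4 loc x0 y0 k0 k0_gt0; apply: contrapT => nP.
pose T := {q : R * R * R | 0 < q.2 /\ ~ P q.1.1 q.1.2 q.2}.
pose S (q r : T) := let: (x, y, k) := sval q in let: (x', y', k') := sval r in
  [/\ k' = k / 2, x <= x' <= x + w * (k / 2) & y <= y' <= y + h * (k / 2)].
have next (q : T) : {r : T | S q r}.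
  apply: cid; case: q => [[[x y] k] /= [kgt0 nPk]].
  have k2 : 0 < k / 2 by rewrite divr_gt0.
  have wk : 0 <= w * (k / 2) by rewrite mulr_ge0 // ltW.
  have hk : 0 <= h * (k / 2) by rewrite mulr_ge0 // ltW.
  suff [x' [y' [hx hy nP']]] : exists x' y', [/\ x <= x' <= x + w * (k / 2),
      y <= y' <= y + h * (k / 2) & ~ P x' y' (k / 2)].
    by exists (exist _ (x', y', k / 2) (conj k2 nP')).
  apply: contrapT => none; apply: nPk; apply: split4 => //; apply: contrapT => nP';
    apply: none; do 2 eexists; split; try exact: nP';
    by rewrite ?lexx ?lerDl ?wk ?hk.
have [F [F0 FS]] := dependent_choice next (exist _ (x0, y0, k0) (conj k0_gt0 nP) : T).
pose X n := (sval (F n)).1.1; pose Y n := (sval (F n)).1.2.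
pose K n := (sval (F n)).2.
have step n : [/\ K n.+1 = K n / 2, X n <= X n.+1 <= X n + w * (K n / 2) &
                  Y n <= Y n.+1 <= Y n + h * (K n / 2)].
  by have := FS n; rewrite /S /K /X /Y; case: (F n) => [[[? ?] ?] ?];
    case: (F n.+1) => [[[? ?] ?] ?].
have FP n : 0 < K n /\ ~ P (X n) (Y n) (K n) by case: (svalP (F n)).
have KE n : K n = k0 / 2 ^+ n.
  elim: n => [|n IH]; first by rewrite expr0 divr1 /K F0.
  by have [-> _ _] := step n; rewrite IH exprSr invfM mulrA.
have limit (v : R) (Z : nat -> R) : 0 <= v ->
    (forall n, Z n <= Z n.+1 <= Z n + v * (K n / 2)) ->
    exists c, forall n, Z n <= c <= Z n + v * K n.
  move=> v0 hZ.
  (* The right ends decrease and the left ends increase, so the supremum of the left ends lies in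
     every interval. *)
  have hi n m : Z (n + m)%N + v * K (n + m)%N <= Z n + v * K n.
    elim: m => [|m IH]; first by rewrite addn0.
    apply: le_trans IH; rewrite addnS; have /andP[_ h1] := hZ (n + m)%N.
    have [-> _ _] := step (n + m)%N.
    by rewrite (le_trans (lerD h1 (lexx _))) // -addrA -mulrDr -splitr.
  have lo n m : Z n <= Z (n + m)%N.
    elim: m => [|m IH]; first by rewrite addn0.
    by apply: (le_trans IH); rewrite addnS; case/andP: (hZ (n + m)%N).
  have vK n : 0 <= v * K n by rewrite mulr_ge0 // ltW //; case: (FP n).
  have ub n : ubound (range Z) (Z n + v * K n).
    move=> _ [m _ <-].
    have := lo m n; rewrite addnC => hm; apply: (le_trans hm).
    by apply: le_trans (hi n m); rewrite lerDl.
  have hs : has_sup (range Z).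
    by split; [exists (Z 0%N); exists 0%N|exists (Z 0%N + v * K 0%N); exact: ub].
  exists (sup (range Z)) => n; apply/andP; split.
    by apply: ub_le_sup; [case: hs|exists n].
  by apply: ge_sup; [case: hs|exact: ub].
have [|cx hcx] := limit w X w0; first by move=> n; case: (step n).
have [|cy hcy] := limit h Y h0; first by move=> n; case: (step n).
have [d d0 D] := loc cx cy.
have [n Kn] : exists n, K n < d.
  (* With n > k0 / d the scale k0 / 2^n is below [d], since n < 2^n. *)
  exists (Num.truncn (k0 / d)).+1; rewrite KE ltr_pdivrMr ?exprn_gt0 // mulrC
    -ltr_pdivrMr //.
  apply: (@lt_trans _ _ (Num.truncn (k0 / d)).+1%:R); first exact: truncnS_gt.
  by rewrite -natrX ltr_nat ltn_expl.
have [Kn0 []] := FP n; apply: (D _ _ _ _ (hcx n) (hcy n)).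
by rewrite Kn0.
Qed.

Lemma border_derivable f x0 x1 y0 y1 :
  (forall x, x0 <= x <= x1 -> derivable f (x +i* y0) 1 /\ derivable f (x +i* y1) 1) ->
  (forall y, y0 <= y <= y1 -> derivable f (x0 +i* y) 1 /\ derivable f (x1 +i* y) 1) ->
  continuous_on_border f x0 x1 y0 y1.
Proof.
move=> h1 h2; split=> t ht.
  by have [a b] := h1 t ht; split; exact: derivable_ccontinuous.
by have [a b] := h2 t ht; split; exact: derivable_ccontinuous.
Qed.

Lemma goursat f x0 x1 y0 y1 : x0 <= x1 -> y0 <= y1 ->
  (forall x y, x0 <= x <= x1 -> y0 <= y <= y1 -> derivable f (x +i* y) 1) ->
  rect_int f x0 x1 y0 y1 = 0.
Proof.
move=> x01 y01 df.
have bd a b c d : x0 <= a -> a <= b -> b <= x1 -> y0 <= c -> c <= d -> d <= y1 ->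
    continuous_on_border f a b c d.
  move=> xa ab bx yc cd dy; apply: border_derivable => t /andP[t1 t2];
   split; apply: df; apply/andP; split => //;
   by [exact: le_trans t1|exact: le_trans bx|exact: le_trans xa _|exact: le_trans dy
      |exact: le_trans yc _|exact: le_trans t2 _|exact: le_trans cd _|exact: le_trans ab _
      |exact: le_trans dy|exact: le_trans bx].
pose w := x1 - x0; pose h := y1 - y0.
have w0 : 0 <= w by rewrite subr_ge0.
have h0 : 0 <= h by rewrite subr_ge0.
have wE : x0 + w = x1 by rewrite addrC subrK.
have hE : y0 + h = y1 by rewrite addrC subrK.
clearbody w h.
(* The bound [e * k ^+ 2] for the rectangle scaled by [k] follows from the same
   bound for its four halves, and holds for small [k] because the integral of the
   affine approximation of [f] vanishes. *)
suff H (e : R) : 0 < e -> normc (rect_int f x0 x1 y0 y1) <= e.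
  apply/eqP; rewrite -normc_eq0 eq_le normc_ge0 andbT.
  by apply/ler_addgt0Pl => e /H; rewrite addr0.
move=> e0.
(* The bisection principle ranges over all rectangles of the plane; the premises make the bound
   vacuous for those that leave the given one. *)
pose P x y k := x0 <= x -> x + w * k <= x1 -> y0 <= y -> y + h * k <= y1 ->
  normc (rect_int f x (x + w * k) y (y + h * k)) <= e * k ^+ 2.
suff : P x0 y0 1.
  by rewrite /P !mulr1 expr1n mulr1 wE hE; apply.
apply: (@rectangle_bisection w h P w0 h0 _ _ x0 y0 1 ltr01); last first.
- move=> cx cy; have [cin|cout] := pselect (x0 <= cx <= x1 /\ y0 <= cy <= y1); last first.
    exists 1 => // x y k /andP[k0 k1] /andP[xc cxx] /andP[yc cyy] h1 h2 h3 h4.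
    case: cout; split; apply/andP; split.
    - exact: le_trans xc.
    - exact: le_trans h2.
    - exact: le_trans yc.
    - exact: le_trans h4.
  have /has_cderivP[d dd] := df _ _ cin.1 cin.2.
  pose c : R[i] := cx +i* cy.
  (* [rect_int_le] yields 4 eps ((w + h) k)^2 when the error is eps |z - c|, whence the choice of
     eps below; the [+ 1] keeps the divisor positive for a degenerate rectangle. *)
  have q0 : 0 < 4 * ((w + h) ^+ 2 + 1) by rewrite mulr_gt0 // ltr_wpDl ?sqr_ge0.
  have [|r r0 D] := dd (e / (4 * ((w + h) ^+ 2 + 1))); first by rewrite divr_gt0.
  have wh1 : 0 < w + h + 1 by lra.
  exists (r / (w + h + 1)) => [|x y k /andP[k0 k1] xc yc h1 h2 h3 h4];
    first by rewrite divr_gt0.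
  have wk : 0 <= w * k by rewrite mulr_ge0 // ltW.
  have hk : 0 <= h * k by rewrite mulr_ge0 // ltW.
  have xw : x <= x + w * k by rewrite lerDl.
  have yh : y <= y + h * k by rewrite lerDl.
  have bf : continuous_on_border f x (x + w * k) y (y + h * k) by exact: bd.
  (* Minus the affine approximation of [f] at [c], so that [1 * f + g] is the remainder in the shape
     asked for by [rect_int_lin]. *)
  pose g (z : C) : C := (- d) * z + (d * c - f c).
  have bg : continuous_on_border g x (x + w * k) y (y + h * k).
    by apply: border_derivable => t _; split; apply: derivableD => //;
      apply: derivableM.
  have near_c a b : x <= a <= x + w * k -> y <= b <= y + h * k ->
      normc ((a +i* b) - c) <= (w + h) * k.
    move=> /andP[a1 a2] /andP[b1 b2]; rewrite (le_trans (normc_le_ReIm _)) //=.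
    rewrite mulrDl; case/andP: xc => c1 c2; case/andP: yc => c3 c4.
    by apply: lerD; rewrite ler_norml; apply/andP; split; lra.
  have small a b : x <= a <= x + w * k -> y <= b <= y + h * k ->
      normc (1 * f (a +i* b) + g (a +i* b)) <=
      e / (4 * ((w + h) ^+ 2 + 1)) * ((w + h) * k).
    move=> ha hb; have hc := near_c a b ha hb.
    have -> : 1 * f (a +i* b) + g (a +i* b) =
      f (a +i* b) - f c - d * ((a +i* b) - c) by rewrite /g; ring.
    apply: le_trans (D _ _) _.
      apply: (le_lt_trans hc); apply: (@le_lt_trans _ _ ((w + h + 1) * k)).
        by rewrite ler_wpM2r ?lerDl // ltW.
      by rewrite mulrC -ltr_pdivlMr.
    by rewrite ler_wpM2l // divr_ge0 // ltW.
  have -> : rect_int f x (x + w * k) y (y + h * k) =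
     rect_int (fun z => 1 * f z + g z) x (x + w * k) y (y + h * k).
    by rewrite rect_int_lin // rect_int_affine // mul1r addr0.
  have ex : x <= x <= x + w * k by rewrite lexx.
  have ex' : x <= x + w * k <= x + w * k by rewrite lexx andbT.
  have ey : y <= y <= y + h * k by rewrite lexx.
  have ey' : y <= y + h * k <= y + h * k by rewrite lexx andbT.
  apply: le_trans (rect_int_le xw yh (border_lin 1 bf bg) _ _) _.
  - by move=> t ht; split; exact: small.
  - by move=> t ht; split; exact: small.
  rewrite [x + _]addrC [y + _]addrC !addrK -mulrDl.
  have -> : 4 * (e / (4 * ((w + h) ^+ 2 + 1)) * ((w + h) * k)) * ((w + h) * k) =
     e * k ^+ 2 * ((w + h) ^+ 2 / ((w + h) ^+ 2 + 1)).
    by field; rewrite gt_eqF // ltr_wpDl ?sqr_ge0.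
  apply: ler_piMr; first by rewrite mulr_ge0 ?sqr_ge0 // ltW.
  by rewrite ler_pdivrMr ?mul1r ?lerDl // ltr_wpDl ?sqr_ge0.
- move=> x y k k0 P1 P2 P3 P4 h1 h2 h3 h4.
  have wk : 0 <= w * (k / 2) by rewrite mulr_ge0 // divr_ge0 // ltW.
  have hk : 0 <= h * (k / 2) by rewrite mulr_ge0 // divr_ge0 // ltW.
  have wkE : x + w * k = x + w * (k / 2) + w * (k / 2) by field.
  have hkE : y + h * k = y + h * (k / 2) + h * (k / 2) by field.
  rewrite wkE in h2; rewrite hkE in h4; rewrite wkE hkE.
  set p := x + w * (k / 2) in P2 P4 h2 *; set q := y + h * (k / 2) in P3 P4 h4 *.
  have xp : x <= p by rewrite lerDl.
  have yq : y <= q by rewrite lerDl.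
  have pp : p <= p + w * (k / 2) by rewrite lerDl.
  have qq : q <= q + h * (k / 2) by rewrite lerDl.
  have px : p <= x1 by exact: le_trans h2.
  have qy : q <= y1 by exact: le_trans h4.
  have xp0 : x0 <= p by exact: le_trans xp.
  have yq0 : y0 <= q by exact: le_trans yq.
  have xp' : x <= p <= p + w * (k / 2) by rewrite xp pp.
  have yq' : y <= q <= q + h * (k / 2) by rewrite yq qq.
  have yqq : y <= q + h * (k / 2) := le_trans yq qq.
  have c1 := bd _ _ _ _ h1 xp px h3 yqq h4.
  have c2 := bd _ _ _ _ xp0 pp h2 h3 yqq h4.
  have c3 := bd _ _ _ _ h1 xp px h3 yq qy.
  have c4 := bd _ _ _ _ h1 xp px yq0 qq h4.
  have c5 := bd _ _ _ _ xp0 pp h2 h3 yq qy.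
  have c6 := bd _ _ _ _ xp0 pp h2 yq0 qq h4.
  rewrite (rect_int_cut_ver xp' c1 c2) (rect_int_cut_hor yq' c3 c4).
  rewrite (rect_int_cut_hor yq' c5 c6).
  have -> : e * k ^+ 2 = (e * (k / 2) ^+ 2 + e * (k / 2) ^+ 2) +
     (e * (k / 2) ^+ 2 + e * (k / 2) ^+ 2) by field.
  apply: le_trans (normcD _ _) _; apply: lerD; apply: le_trans (normcD _ _) _; apply: lerD.
  - exact: P1.
  - exact: P3.
  - exact: P2.
  - exact: P4.
Qed.

End Goursat.

Section RectangleShrinking.
Variable R : realType.

Local Notation C := (R[i]^o).
Implicit Types (f : C -> C) (x y : R).

(** Cutting off the left, right, bottom and top strips around the small square leaves the
    exceptional point inside the square, and Goursat's theorem annihilates each strip. *)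
Lemma rect_int_shrink f x0 x1 y0 y1 px py (e : R) : 0 < e ->
  x0 < px - e -> px + e < x1 -> y0 < py - e -> py + e < y1 ->
  (forall x y, x0 <= x <= x1 -> y0 <= y <= y1 -> x +i* y != px +i* py ->
     derivable f (x +i* y) 1) ->
  rect_int f x0 x1 y0 y1 = rect_int f (px - e) (px + e) (py - e) (py + e).
Proof.
move=> e0 hx0 hx1 hy0 hy1 df.
have ne x y : ~~ ((x == px) && (y == py)) -> x +i* y != px +i* py by rewrite eq_complex.
have ltn_neq (a b : R) : a < b -> (a == b) = false by move=> /lt_eqF.
have bd a b c d : x0 <= a -> a <= b -> b <= x1 -> y0 <= c -> c <= d -> d <= y1 ->
    a != px -> b != px -> c != py -> d != py -> continuous_on_border f a b c d.
  move=> xa ab bx yc cd dy ap bp cp dp.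
  by apply: border_derivable => t /andP[t1 t2]; split; apply: df;
    rewrite ?ne ?negb_and ?ap ?bp ?cp ?dp ?orbT //; apply/andP; split; lra.
have G a b c d : x0 <= a -> a <= b -> b <= x1 -> y0 <= c -> c <= d -> d <= y1 ->
    [|| px < a, b < px, py < c | d < py] -> rect_int f a b c d = 0.
  move=> xa ab bx yc cd dy out; apply: goursat => // x y /andP[h1 h2] /andP[h3 h4].
  apply: df; [by apply/andP; split; lra|by apply/andP; split; lra|].
  apply/negP => /eqP [xE yE]; subst.
  by case/or4P: out => h; lra.
have nx0 : px - e != px by rewrite lt_eqF // ltrBlDr ltrDl.
have nx1 : px + e != px by rewrite gt_eqF // ltrDl.
have ny0 : py - e != py by rewrite lt_eqF // ltrBlDr ltrDl.
have ny1 : py + e != py by rewrite gt_eqF // ltrDl.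
have nx2 : x0 != px by rewrite lt_eqF //; lra.
have nx3 : x1 != px by rewrite gt_eqF //; lra.
have ny2 : y0 != py by rewrite lt_eqF //; lra.
have ny3 : y1 != py by rewrite gt_eqF //; lra.
rewrite (@rect_int_cut_ver _ f x0 (px - e) x1); [|by apply/andP; split;
  lra|by apply: bd => //; lra..].
rewrite (G x0 (px - e) y0 y1); [|lra..|by apply/or4P; apply: Or42; lra].
rewrite (@rect_int_cut_ver _ f (px - e) (px + e) x1); [|by apply/andP; split;
  lra|by apply: bd => //; lra..].
rewrite (G (px + e) x1 y0 y1); [|lra..|by apply/or4P; apply: Or41; lra].
rewrite (@rect_int_cut_hor _ f (px - e) (px + e) y0 (py - e) y1); [|by apply/andP;
  split; lra|by apply: bd => //; lra..].
rewrite (G (px - e) (px + e) y0 (py - e)); [|lra..|by apply/or4P; apply: Or44; lra].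
rewrite (@rect_int_cut_hor _ f (px - e) (px + e) (py - e) (py + e) y1);
  [|by apply/andP; split; lra|by apply: bd => //; lra..].
rewrite (G (px - e) (px + e) (py + e) y1); [|lra..|by apply/or4P; apply: Or43; lra].
by rewrite !add0r !addr0.
Qed.

End RectangleShrinking.

Section Cauchy.
Variable R : realType.

Local Notation C := (R[i]^o).
Local Notation normc := (@Normc.normc R).
Local Notation mu := (@lebesgue_measure R).
Implicit Types (f g : C -> C) (x y : R).

(** The primitive [atan ((t - p) / e)] runs from - pi / 4 to pi / 4. *)
Lemma Rintegral_atan (p e : R) : 0 < e ->
  (\int[mu]_(t in `[(p - e), (p + e)]) (e / (e ^+ 2 + (t - p) ^+ 2)))%R = pi / 2.
Proof.
move=> e0; have e1 : e != 0 by rewrite gt_eqF.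
pose F (t : R) : R := atan ((t - p) / e).
have dF t : is_derive t (1 : R) F (e / (e ^+ 2 + (t - p) ^+ 2)).
  have d1 : is_derive t (1 : R) (fun t : R => (t - p) / e) e^-1.
    apply: is_derive_eq; rewrite /GRing.scale /= ; ring.
  apply: is_derive_eq.
  rewrite /GRing.scale /=; field.
  by rewrite e1 !gt_eqF ?ltr_pwDl ?ltr_pwDr ?sqr_ge0 ?exprn_gt0 ?divr_gt0.
have cF : forall s, {for s, continuous F}.
  move=> t; apply: differentiable_continuous; apply/derivable1_diffP; by case: (dF t).
transitivity (F (p + e) - F (p - e)); last first.
  rewrite /F addrAC subrr add0r divff // addrAC subrr add0r mulNr divff // atanN atan1.
  by field.
rewrite /Rintegral (@continuous_FTC2 _ _ F) //.
- by rewrite ltrD2l; lra.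
- apply: continuous_subspaceT => t.
  apply: cvgM; first exact: cvg_cst.
  apply: cvgV; first by rewrite gt_eqF // ltr_pwDl ?sqr_ge0 ?exprn_gt0.
  apply: cvgD; first exact: cvg_cst.
  by apply: cvgM; (apply: cvgB; [exact: cvg_id|exact: cvg_cst]).
- split.
  + by move=> t _; case: (dF t).
  + exact/cvg_at_right_filter/cF.
  + exact/cvg_at_left_filter/cF.
- by move=> t _; rewrite derive1E; case: (dF t) => _ ->.
Qed.

(** On a square centred at the pole the values of 1 / (z - p) on opposite sides differ by 2 e / (e^2
    + t^2), up to the factor ['i] for the horizontal sides; each pair of sides therefore contributes
    ['i * pi]. *)
Lemma rect_int_inv (px py e : R) : 0 < e ->
  rect_int (fun z => (z - (px +i* py))^-1) (px - e) (px + e) (py - e) (py + e) =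
  2 * 'i * pi%:C.
Proof.
move=> e0; rewrite /rect_int.
have ne t : e ^+ 2 + t ^+ 2 != 0 by rewrite gt_eqF // ltr_pwDl ?sqr_ge0 ?exprn_gt0.
have H p : path_int (fun t => 0 +i* (2 * (e / (e ^+ 2 + (t - p) ^+ 2)))) (p - e) (p + e) =
   'i * pi%:C /\ path_int (fun t => (2 * (e / (e ^+ 2 + (t - p) ^+ 2))) +i* 0) (p - e)
     (p + e) = pi%:C.
  have it : mu.-integrable `[(p - e), (p + e)] (EFin \o (fun t => e / (e ^+ 2 + (t - p)
    ^+ 2))).
    apply: (@continuous_compact_integrable R); first exact: segment_compact.
    apply: continuous_subspaceT => t.
    apply: cvgM; first exact: cvg_cst.
    apply: cvgV; first exact: ne.
    apply: cvgD; first exact: cvg_cst.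
    by apply: cvgM; (apply: cvgB; [exact: cvg_id|exact: cvg_cst]).
  have sc : (\int[mu]_(t in `[(p - e), (p + e)]) (2 * (e / (e ^+ 2 + (t - p) ^+ 2))))%R
    = pi :> R.
    by rewrite (RintegralZl 2 _ it) // Rintegral_atan //; field.
  rewrite /path_int /= sc Rintegral_segment_cst; last lra.
  by rewrite mul0r; split => //; apply/eqP; rewrite eq_complex /=; apply/andP; split;
    apply/eqP; ring.
transitivity (path_int (fun t => 0 +i* (2 * (e / (e ^+ 2 + (t - px) ^+ 2)))) (px - e)
  (px + e)
  + 'i * path_int (fun t => (2 * (e / (e ^+ 2 + (t - py) ^+ 2))) +i* 0) (py - e) (py +
    e)); last first.
  by rewrite (H px).1 (H py).2; ring.
have k1 q : q - e - q = - e by ring.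
have k2 q : q + e - q = e by ring.
congr (_ + _ * _); apply: eq_path_int => t _; apply/eqP; rewrite eq_complex /=;
 rewrite !(k1, k2) !sqrrN.
- have n1 := ne (t - px); move: (t - px) n1 => a n1.
  have n2 : a ^+ 2 + e ^+ 2 != 0 by rewrite addrC.
  by apply/andP; split; apply/eqP; field; rewrite ?n1 ?n2.
- have n1 := ne (t - py); move: (t - py) n1 => a n1.
  by apply/andP; split; apply/eqP; field; rewrite ?n1.
Qed.

Lemma derivable_sub_cst (z w : C) : derivable (fun v : C => v - z) w 1.
Proof. by apply: derivableB; [exact: derivable_id|exact: derivable_cst]. Qed.

Lemma shrink_bounds (p e s : R) : 0 < e -> e < s - `|p| ->
  [/\ - s < p - e, p - e < p, p < p + e & p + e < s].
Proof.
move=> e0 es; have := ler_norm p; have := ler_norm (- p); rewrite normrN => h1 h2.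
by split; lra.
Qed.

(** The integrand is f(z) / (w - z) plus the difference quotient of [f]. The latter is bounded near
    [z], and its integral can be taken over arbitrarily small squares around [z], so it is 0; the
    former is [rect_int_inv]. *)
Lemma cauchy_formula f s (z : C) : `|complex.Re z| < s -> `|complex.Im z| < s ->
  (forall x y, `|x| <= s -> `|y| <= s -> derivable f (x +i* y) 1) ->
  rect_int (fun w => f w / (w - z)) (- s) s (- s) s = 2 * 'i * pi%:C * f z.
Proof.
case: z => px py /= hx hy df.
have s0 : 0 < s by exact: le_lt_trans hx.
set z : C := px +i* py.
have Dinv (w : C) : w != z -> derivable (fun w : C => (w - z)^-1) w 1.
  by move=> wz; apply: derivableV; [rewrite subr_eq0|exact: derivable_sub_cst].
have brd (g : C -> C) a b c d : (forall w, w != z -> - s <= complex.Re w <= s ->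
    - s <= complex.Im w <= s -> derivable g w 1) ->
    - s <= a -> a < px -> px < b -> b <= s -> - s <= c -> c < py -> py < d -> d <= s ->
    continuous_on_border g a b c d.
  move=> dg a1 a2 b1 b2 c1 c2 d1 d2.
  have ne x y : (x != px) || (y != py) -> x +i* y != z.
    by rewrite eq_complex negb_and.
  apply: border_derivable => t /andP[t1 t2]; split; apply: dg => //=;
    by [apply: ne; rewrite ?(lt_eqF a2) ?(gt_eqF b1) ?(lt_eqF c2) ?(gt_eqF d1) ?orbT
       |apply/andP; split; clear - a1 a2 b1 b2 c1 c2 d1 d2 t1 t2; lra].
have dsq (w : C) : - s <= complex.Re w <= s -> - s <= complex.Im w <= s -> derivable f w 1.
  by case: w => x y /= h1 h2; apply: df; rewrite ler_norml.
pose g (w : C) : C := (f w - f z) / (w - z).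
have Dg w : w != z -> - s <= complex.Re w <= s -> - s <= complex.Im w <= s -> derivable
  g w 1.
  move=> wz h1 h2; apply: derivableM; last exact: Dinv.
  by apply: derivableB; [exact: dsq|exact: derivable_cst].
have Di w : w != z -> - s <= complex.Re w <= s -> - s <= complex.Im w <= s ->
    derivable (fun w : C => (w - z)^-1) w 1 by move=> wz _ _; exact: Dinv.
have [hx1 hx2] : - s < px /\ px < s by move: hx; rewrite ltr_norml => /andP.
have [hy1 hy2] : - s < py /\ py < s by move: hy; rewrite ltr_norml => /andP.
have shrink (h : C -> C) e : (forall w, w != z -> - s <= complex.Re w <= s ->
    - s <= complex.Im w <= s -> derivable h w 1) ->
    0 < e -> e < s - `|px| -> e < s - `|py| ->
    rect_int h (- s) s (- s) s = rect_int h (px - e) (px + e) (py - e) (py + e).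
  move=> dh e0 e1 e2; have [X1 X2 X3 X4] := shrink_bounds e0 e1.
  have [Y1 Y2 Y3 Y4] := shrink_bounds e0 e2.
  apply: rect_int_shrink => //.
  by move=> x y h5 h6 h7; exact: dh.
have e0P : 0 < Num.min (s - `|px|) (s - `|py|) / 2.
  by rewrite divr_gt0 // lt_min !subr_gt0 hx hy.
have g0 : rect_int g (- s) s (- s) s = 0.
  apply/eqP; rewrite -normc_eq0 eq_le normc_ge0 andbT; apply/ler_addgt0Pl => u u0;
    rewrite addr0.
  have /has_cderivP[d /(_ 1 ltr01)[r r0 H]] : derivable f z 1 by apply: df; exact: ltW.
  have m0 : 0 < normc d + 1 by rewrite ltr_wpDl ?normc_ge0.
  (* The square must lie inside the large one, its points must be at distance at most 2 e < r from
     [z], and its perimeter, proportional to [e], must bring the estimate 4 (|d| + 1) 4 e below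
     [u]. *)
  pose e := Num.min (Num.min (s - `|px|) (s - `|py|) / 2)
                    (Num.min (r / 3) (u / (16 * (normc d + 1)))).
  have e0 : 0 < e by rewrite !lt_min e0P !divr_gt0 // mulr_gt0.
  have le1 : e <= Num.min (s - `|px|) (s - `|py|) / 2 by rewrite ge_min lexx.
  have le2 : e <= r / 3 by rewrite !ge_min lexx /= orbT.
  have le3 : e <= u / (16 * (normc d + 1)) by rewrite !ge_min lexx /= !orbT.
  have [le4 le5] : e < s - `|px| /\ e < s - `|py|.
    by split; apply: (le_lt_trans le1); rewrite ltr_pdivrMr // gt_min; apply/orP;
      [left|right];
      rewrite mulr_natr mulr2n ltrDl subr_gt0.
  clearbody e.
  rewrite (shrink g e) //.
  have gm w : w != z -> normc (w - z) < r -> normc (g w) <= normc d + 1.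
    move=> wz wr; rewrite normcM normcV ler_pdivrMr ?normc_gt0 ?subr_eq0 //.
    rewrite -[f w - f z](subrK (d * (w - z))) (le_trans (normcD _ _)) //.
    by rewrite [leRHS]mulrDl addrC normcM lerD2l; exact: H.
  have near x y : `|x - px| <= e -> `|y - py| <= e -> normc ((x +i* y) - z) < r.
    move=> h1 h2; rewrite (le_lt_trans (normc_le_ReIm _)) //=.
    by rewrite (le_lt_trans (lerD h1 h2)) //; clear -le2 r0; lra.
  have ne x y : (x != px) || (y != py) -> x +i* y != z by rewrite eq_complex negb_and.
  have ee : `|e| <= e by rewrite ger0_norm // ltW.
  have [X1 X2 X3 X4] := shrink_bounds e0 le4.
  have [Y1 Y2 Y3 Y4] := shrink_bounds e0 le5.
  have k1 q : q - e - q = - e by ring.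
  have k2 q : q + e - q = e by ring.
  have kt (q t : R) : q - e <= t <= q + e -> `|t - q| <= e by rewrite ler_distl.
  apply: (@le_trans _ _ (4 * (normc d + 1) * ((px + e - (px - e)) + (py + e - (py - e))))).
    apply: rect_int_le; [exact: ltW (lt_trans X2 X3)|exact: ltW (lt_trans Y2 Y3)| | |].
    - by apply: brd => //; exact: ltW.
    - move=> t /kt ht; split; apply: gm; rewrite ?ne ?(lt_eqF Y2) ?(gt_eqF Y3) ?orbT //;
        apply: near => //.
      + by rewrite k1 normrN.
      + by rewrite k2.
    - move=> t /kt ht; split; apply: gm; rewrite ?ne ?(lt_eqF X2) ?(gt_eqF X3) //;
        apply: near => //.
      + by rewrite k1 normrN.
      + by rewrite k2.
  have -> : 4 * (normc d + 1) * ((px + e - (px - e)) + (py + e - (py - e))) =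
     e * (16 * (normc d + 1)) by ring.
  by rewrite -ler_pdivlMr // mulr_gt0.
have bg : continuous_on_border g (- s) s (- s) s by exact: brd.
have bi : continuous_on_border (fun w : C => (w - z)^-1) (- s) s (- s) s by exact: brd.
rewrite (@eq_rect_int _ _ (fun w => f z * (w - z)^-1 + g w)); first last.
- by move=> y _; rewrite /g; split; ring.
- by move=> x _; rewrite /g; split; ring.
rewrite rect_int_lin // g0 addr0.
rewrite (shrink _ _ Di e0P).
- by rewrite rect_int_inv // mulrC.
- by rewrite ltr_pdivrMr // gt_min; apply/orP; left;
    rewrite mulr_natr mulr2n ltrDl subr_gt0.
- by rewrite ltr_pdivrMr // gt_min; apply/orP; right;
    rewrite mulr_natr mulr2n ltrDl subr_gt0.
Qed.

End Cauchy.

(** * Taylor series *)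

Section Taylor.
Variable R : realType.

Local Notation C := (R[i]^o).
Local Notation normc := (@Normc.normc R).
Implicit Types (f g : C -> C) (x y : R).

(* The bound must be geometric in [n] with a constant independent of [n]: it
   carries the convergence of the series as well as the asymptotic expansions. *)
Definition has_taylor f (a : nat -> R[i]) := exists c k r : R,
  [/\ 0 <= c, 0 < k, 0 < r & forall n z, normc z < r ->
     normc (f z - \sum_(i < n) a i * z ^+ i) <= c * (k * normc z) ^+ n].

Lemma path_bounded (psi : R -> R[i]) a b : a <= b -> path_continuous psi a b ->
  exists m, forall x, a <= x <= b -> normc (psi x) <= m.
Proof.
move=> ab cpsi.
have [|c _ H] := @EVT_max R (fun x => normc (psi x)) a b ab.
  apply: continuous_in_subspaceT => x; rewrite inE /= in_itv /= => xab.
  apply/cvgrPdist_lt => e e0; have [d d0 dP] := cpsi x xab e e0.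
  apply/nbhs_ballP; exists d => // y /= yx.
  have h : normc (psi y - psi x) < e by rewrite dP // distrC.
  rewrite ltr_norml; apply/andP; split.
  - rewrite ltrBrDl ltrBlDr; have := normcD (psi y - psi x) (psi x); rewrite subrK => h2.
    by apply: (le_lt_trans h2); rewrite addrC ltrD2l.
  - rewrite ltrBlDr; have := normcD (psi x - psi y) (psi y); rewrite subrK => h2.
    by apply: (le_lt_trans h2); rewrite ltrD2r normcB.
by exists (normc (psi c)) => x xab; apply: H; rewrite in_itv.
Qed.

(** Cauchy's formula on a square of half-side [s], with 1 / (w - z) replaced by a finite geometric
    sum in z / w plus a remainder. On the contour |w| >= s, so the remainder has size (|z| /
    s)^n. *)
Theorem derivable_taylor f (r0 : R) : 0 < r0 ->
  (forall z : C, normc z < r0 -> derivable f z 1) -> exists a, has_taylor f a.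
Proof.
move=> r0_gt0 df.
(* Points of the closed square have norm at most 2 s < r0. *)
pose s := r0 / 3; have s0 : 0 < s by rewrite divr_gt0.
have ss : - s <= s by rewrite ge0_cp // ltW.
have df' x y : `|x| <= s -> `|y| <= s -> derivable f (x +i* y) 1.
  move=> h1 h2; apply: df; rewrite (le_lt_trans (normc_le_ReIm _)) //=.
  by rewrite (le_lt_trans (lerD h1 h2)) // /s; lra.
pose A n := rect_int (fun w => f w / w ^+ n.+1) (- s) s (- s) s.
pose u : R[i] := 2 * 'i * pi%:C.
have u0 : u != 0.
  rewrite !mulf_eq0 !negb_or pnatr_eq0 /= -normc_eq0 normci oner_eq0 /=.
  by rewrite -normc_eq0 normc_real normr_eq0 gt_eqF // pi_gt0.
have ns : `|s| <= s by rewrite ger0_norm // ltW.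
have ns' : `|- s| <= s by rewrite normrN.
have nt t : - s <= t <= s -> `|t| <= s by rewrite ler_norml.
have ge_s x y : `|x| <= s -> `|y| <= s -> (`|x| == s) || (`|y| == s) ->
    s <= normc (x +i* y).
  move=> _ _ /orP[/eqP <-|/eqP <-].
    exact: (Re_le_normc (x +i* y)).
  exact: (Im_le_normc (x +i* y)).
(* Treats the four sides at once: all that matters about a border point is that it lies in the
   square and has norm at least [s]. *)
have edge (Q : C -> Prop) : (forall x y, `|x| <= s -> `|y| <= s ->
      s <= normc (x +i* y) -> Q (x +i* y)) ->
    (forall x, - s <= x <= s -> Q (x +i* - s) /\ Q (x +i* s)) /\
    (forall y, - s <= y <= s -> Q (- s +i* y) /\ Q (s +i* y)).
  move=> HQ; split=> t /nt ht; split; apply: HQ => //; apply: ge_s => //;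
    by rewrite ?normrN (ger0_norm (ltW s0)) eqxx ?orbT.
have brd (g : C -> C) : (forall x y, `|x| <= s -> `|y| <= s ->
      s <= normc (x +i* y) -> derivable g (x +i* y) 1) ->
    continuous_on_border g (- s) s (- s) s.
  move=> H; have [h1 h2] := edge (fun w => derivable g w 1) H.
  exact (border_derivable h1 h2).
have [m [m0 fm]] : exists m, 0 <= m /\ forall x y, `|x| <= s -> `|y| <= s ->
    (`|x| == s) || (`|y| == s) -> normc (f (x +i* y)) <= m.
  have [p1 p2] := border_hor (brd _ (fun x y h1 h2 _ => df' x y h1 h2)).
  have [q1 q2] := border_ver (brd _ (fun x y h1 h2 _ => df' x y h1 h2)).
  have [m1 h1] := path_bounded ss p1; have [m2 h2] := path_bounded ss p2.
  have [m3 h3] := path_bounded ss q1; have [m4 h4] := path_bounded ss q2.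
  exists (`|m1| + `|m2| + `|m3| + `|m4|); split=> [|x y hx hy]; first by rewrite !addr_ge0.
  have := ler_norm m1; have := ler_norm m2; have := ler_norm m3; have := ler_norm m4.
  have := normr_ge0 m1; have := normr_ge0 m2; have := normr_ge0 m3; have := normr_ge0 m4.
  move=> k1 k2 k3 k4 k5 k6 k7 k8.
  rewrite !eqr_norml (ltW s0) !andbT.
  have {}hx : - s <= x <= s by rewrite -ler_norml.
  have {}hy : - s <= y <= s by rewrite -ler_norml.
  case/orP=> /orP[] /eqP E; subst.
  - by apply: le_trans (h4 _ hy) _; lra.
  - by apply: le_trans (h3 _ hy) _; lra.
  - by apply: le_trans (h2 _ hx) _; lra.
  - by apply: le_trans (h1 _ hx) _; lra.
(* On the border |f| <= m, |w| >= s and, for |z| < s / 2, |w - z| >= s / 2; [4] and [4 * s] are the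
   factor and the sum of the two side lengths in [rect_int_le]. *)
exists (fun i => u^-1 * A i), (normc u^-1 * (4 * (m / (s / 2)) * (4 * s))), s^-1, (s /
  2); split.
- apply: mulr_ge0; first exact: normc_ge0.
  apply: mulr_ge0; last by apply: mulr_ge0 => //; exact: ltW.
  by apply: mulr_ge0 => //; apply: divr_ge0 => //; apply: divr_ge0 => //; exact: ltW.
- by rewrite invr_gt0.
- by rewrite divr_gt0.
move=> n z zs.
have far x y : s <= normc (x +i* y) -> s / 2 <= normc ((x +i* y) - z).
  move=> h; have := normcD ((x +i* y) - z) z; rewrite subrK => h2; lra.
have nz0 (w : C) (v : R) : 0 < v -> v <= normc w -> w != 0.
  by move=> v0 vw; rewrite -normc_gt0; exact: lt_le_trans vw.
have s2 : 0 < s / 2 by rewrite divr_gt0.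
(* Remainder of the geometric expansion of [1 / (w - z)] in Cauchy's formula. *)
pose B n := rect_int (fun w => f w * (z ^+ n / (w ^+ n * (w - z)))) (- s) s (- s) s.
have bA i : continuous_on_border (fun w => f w / w ^+ i.+1) (- s) s (- s) s.
  apply: brd => x y hx hy h; apply: derivableM; first exact: df'.
  apply: derivableV; first by rewrite expf_neq0 // (nz0 _ _ s0 h).
  exact: exprn_derivable.
have bB i : continuous_on_border (fun w => f w * (z ^+ i / (w ^+ i * (w - z)))) (- s) s
  (- s) s.
  apply: brd => x y hx hy h; apply: derivableM; first exact: df'.
  apply: derivableM; first exact: derivable_cst.
  apply: derivableV.
    by rewrite mulf_neq0 ?expf_neq0 ?(nz0 _ _ s0 h) ?(nz0 _ _ s2 (far _ _ h)).
  by apply: derivableM; [exact: exprn_derivable|exact: derivable_sub_cst].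
have fE : u * f z = B 0%N.
  rewrite /u -(@cauchy_formula _ f s) //.
  - by apply: eq_rect_int => t _; split; rewrite !expr0 !mul1r.
  - by rewrite (le_lt_trans (Re_le_normc _)) //; lra.
  - by rewrite (le_lt_trans (Im_le_normc _)) //; lra.
(* One step of the geometric expansion: 1 / (w - z) = 1 / w + z / (w (w - z)). *)
have BS i : B i = z ^+ i * A i + B i.+1.
  rewrite /B /A -rect_int_lin //.
  have H := edge (fun w => f w * (z ^+ i / (w ^+ i * (w - z))) =
     z ^+ i * (f w / w ^+ i.+1) + f w * (z ^+ i.+1 / (w ^+ i.+1 * (w - z)))).
  have [] := H; last by move=> ? ?; exact: eq_rect_int.
  move=> x y hx hy h; have w0 : (x +i* y) != 0 by exact: nz0 h.
  have wz : (x +i* y) - z != 0 by exact: nz0 (far _ _ h).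
  rewrite !exprS; move: (x +i* y) w0 wz => w w0 wz.
  have wi : w ^+ i != 0 by rewrite expf_neq0.
  by field; rewrite w0 wz wi.
have fS : f z - \sum_(i < n) u^-1 * A i * z ^+ i = u^-1 * B n.
  elim: n {zs} => [|n IH]; first by rewrite big_ord0 subr0 -fE mulKf.
  by rewrite big_ord_recr /= opprD addrA IH (BS n); ring.
rewrite fS normcM -!mulrA ler_wpM2l ?normc_ge0 //.
set M := m * (s^-1 * normc z) ^+ n / (s / 2).
have hM x y : `|x| <= s -> `|y| <= s -> (`|x| == s) || (`|y| == s) ->
    normc (f (x +i* y) * (z ^+ n / ((x +i* y) ^+ n * ((x +i* y) - z)))) <= M.
  move=> hx hy hxy; have h := ge_s _ _ hx hy hxy.
  rewrite normcM /M -mulrA; apply: ler_pM; rewrite ?normc_ge0 ?fm //.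
  rewrite normcM normcV normcM !normcX invfM mulrA exprMn [_ * normc z ^+ n]mulrC exprVn.
  apply: ler_pM; rewrite ?mulr_ge0 ?exprn_ge0 ?normc_ge0 ?invr_ge0 ?exprn_ge0 ?normc_ge0 //.
    rewrite ler_wpM2l ?exprn_ge0 ?normc_ge0 // lef_pV2 ?posrE ?exprn_gt0 //.
      by rewrite lerXn2r // nnegrE ?normc_ge0 // ltW.
    exact: lt_le_trans h.
  rewrite lef_pV2 ?posrE ?divr_gt0 ?far //.
  by apply: lt_le_trans (far _ _ h); rewrite divr_gt0.
apply: (@le_trans _ _ (4 * M * ((s - - s) + (s - - s)))).
  by apply: rect_int_le => // t /nt ht; split; apply: hM => //;
    rewrite ?normrN (ger0_norm (ltW s0)) eqxx ?orbT.
rewrite /M; set q := (_ * normc z) ^+ n; rewrite le_eqVlt; apply/orP; left; apply/eqP.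
by field; rewrite (gt_eqF s0) (gt_eqF r0_gt0).
Qed.

End Taylor.

(** * Products and uniqueness of power series *)

Section PowerSeries.
Variable R : realType.

Local Notation C := (R[i]^o).
Local Notation normc := (@Normc.normc R).
Implicit Types (f g : C -> C) (a b d : nat -> R[i]).

Lemma cvg_normcP (u : nat -> C) (l : C) : (u @ \oo --> l) <->
  forall e : R, 0 < e -> exists N, forall n, (N <= n)%N -> normc (u n - l) < e.
Proof.
split=> [/cvgrPdist_lt H e e0|H].
  have e0C : 0 < e%:C by rewrite ltcR.
  have [N _ HN] := H _ e0C; exists N => n /HN /=.
  by rewrite norm_normc ltcR normcB.
apply/cvgrPdist_lt => _ /gt0_complexP[e e0 ->]; have [N HN] := H e e0.
by exists N => // n /= /HN; rewrite norm_normc ltcR normcB.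
Qed.

Lemma nbhs_normc2P (P : set (C * C)) (z w : C) :
  (\forall p \near (z, w), P p) <-> exists2 d : R, 0 < d &
    forall p, normc (p.1 - z) < d -> normc (p.2 - w) < d -> P p.
Proof.
split=> [/nbhs_ballP[e /= /gt0_complexP[d d0 ->] dP]|[d d0 dP]].
  exists d => // p h1 h2; apply: dP; split; rewrite /ball /= distrC norm_normc ltcR //.
apply/nbhs_ballP; exists d%:C; first by rewrite /= ltcR.
by move=> p [h1 h2]; apply: dP; rewrite -ltcR -norm_normc distrC.
Qed.

Lemma expr_half_small (c e : R) : 0 < e -> exists N, forall n, (N <= n)%N ->
  c * 2^-1 ^+ n < e.
Proof.
move=> e0; exists (Num.truncn (c / e)).+1 => n hn.
rewrite exprVn ltr_pdivrMr ?exprn_gt0 // mulrC -ltr_pdivrMr //.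
apply: (@lt_trans _ _ n%:R); last by rewrite -natrX ltr_nat ltn_expl.
by apply: lt_le_trans (truncnS_gt _) _; rewrite ler_nat.
Qed.

(** The term a_n t^n is the difference of two consecutive remainders at t = r / 2, which bounds it
    by c (k t)^n (1 + k t). *)
Lemma has_taylor_bounds f a : has_taylor f a -> exists c k r : R,
  [/\ 0 <= c, 0 < k, 0 < r, forall n z, normc z < r ->
     normc (f z - \sum_(i < n) a i * z ^+ i) <= c * (k * normc z) ^+ n &
     forall n, normc (a n) <= c * k ^+ n].
Proof.
move=> [c [k [r [c0 k0 r0 H]]]].
pose t := r / 2; have t0 : 0 < t by rewrite divr_gt0.
have tr : t < r by rewrite ltr_pdivrMr // mulr_natr mulr2n ltrDl.
have nt : normc t%:C = t by rewrite normc_real gtr0_norm.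
have kt : 0 <= k * t by rewrite mulr_ge0 ?ltW.
have cc : c <= c * (1 + k * t) by rewrite ler_peMr // lerDl.
exists (c * (1 + k * t)), k, r; split=> //.
- exact: le_trans cc.
- move=> n z zr; apply: (le_trans (H n z zr)); rewrite ler_wpM2r // exprn_ge0 //.
  by rewrite mulr_ge0 ?normc_ge0 // ltW.
- move=> n; have h1 := H n t%:C; have h2 := H n.+1 t%:C; rewrite nt in h1 h2.
  have {}h1 := h1 tr; have {}h2 := h2 tr.
  have tn : 0 < t ^+ n by rewrite exprn_gt0.
  rewrite -(ler_pM2r tn).
  have -> : normc (a n) * t ^+ n = normc (a n * t%:C ^+ n) by rewrite normcM normcX nt.
  have -> : a n * t%:C ^+ n = (f t%:C - \sum_(i < n) a i * t%:C ^+ i) -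
     (f t%:C - \sum_(i < n.+1) a i * t%:C ^+ i) by rewrite big_ord_recr /=; ring.
  rewrite (le_trans (normcD _ _)) // normcN (le_trans (lerD h1 h2)) //.
  by rewrite exprS exprMn le_eqVlt; apply/orP; left; apply/eqP; ring.
Qed.

(** Rows instead of antidiagonals: the inner sums become partial sums of the second series, to which
    its remainder bound of order n - i applies. *)
Lemma cauchy_product_sum (A B : nat -> R[i]) n :
  \sum_(0 <= j < n) \sum_(i < j.+1) A i * B (j - i)%N =
  \sum_(i < n) A i * \sum_(l < n - i) B l.
Proof.
elim: n => [|n IH]; first by rewrite big_nil big_ord0.
rewrite big_nat_recr //= IH [in RHS]big_ord_recr /= subSnn big_ord1.
rewrite big_ord_recr /= subnn addrA -big_split /=; congr (_ + _).
apply: eq_bigr => i _; rewrite subSn; last exact: ltnW.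
by rewrite big_ord_recr /= mulrDr.
Qed.

Lemma taylor_product f g a b : has_taylor f a -> has_taylor g b ->
  exists2 r : R, 0 < r & forall u v : C, normc u < r -> normc v < r ->
    series (fun j => \sum_(i < j.+1) (a i * u ^+ i) * (b (j - i)%N * v ^+ (j - i)) : C)
      @ \oo --> (f u * g v : C).
Proof.
move=> /has_taylor_bounds[c [k [r [c0 k0 r0 H Ha]]]].
move=> /has_taylor_bounds[c' [k' [r' [c'0 k'0 r'0 H' Hb]]]].
(* With ratios at most 1 / 4 each of the n + 1 error terms is at most c c' / 4^n; since n + 1 <=
   2^n, a factor 2^-n survives. *)
exists (Num.min (Num.min r r') (Num.min (4^-1 / k) (4^-1 / k'))).
  by rewrite !lt_min r0 r'0 !divr_gt0 ?invr_gt0.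
move=> u v; rewrite !lt_min => /andP[/andP[ur _] /andP[uk _]] /andP[/andP[_ vr] /andP[_
  vk]].
have {}uk : k * normc u <= 4^-1 by rewrite mulrC -ler_pdivlMr // ltW.
have {}vk : k' * normc v <= 4^-1 by rewrite mulrC -ler_pdivlMr // ltW.
have u0 : 0 <= k * normc u by rewrite mulr_ge0 ?normc_ge0 // ltW.
have v0 : 0 <= k' * normc v by rewrite mulr_ge0 ?normc_ge0 // ltW.
have main n : normc (series (fun j => \sum_(i < j.+1) (a i * u ^+ i) *
    (b (j - i)%N * v ^+ (j - i)) : C) n - f u * g v) <= c * c' * 2^-1 ^+ n.
  rewrite /series /= (@cauchy_product_sum (fun i => a i * u ^+ i) (fun i => b i * v ^+ i)).
  have gv : normc (g v) <= c'.
    by have := H' 0%N v vr; rewrite big_ord0 subr0 expr0 mulr1.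
  have -> : \sum_(i < n) a i * u ^+ i * (\sum_(l < n - i) b l * v ^+ l) - f u * g v =
     - (\sum_(i < n) a i * u ^+ i * (g v - \sum_(l < n - i) b l * v ^+ l) +
        (f u - \sum_(i < n) a i * u ^+ i) * g v).
    have -> : \sum_(i < n) a i * u ^+ i * (g v - \sum_(l < n - i) b l * v ^+ l) =
        (\sum_(i < n) a i * u ^+ i) * g v -
        \sum_(i < n) a i * u ^+ i * (\sum_(l < n - i) b l * v ^+ l).
      by rewrite mulr_suml -sumrB; apply: eq_bigr => i _; rewrite mulrBr.
    by ring.
  have q4 m (x : R) : 0 <= x -> x <= 4^-1 -> x ^+ m <= 4^-1 ^+ m.
    by move=> x0 x4; rewrite lerXn2r // nnegrE invr_ge0.
  rewrite normcN (le_trans (normcD _ _)) //.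
  apply: (@le_trans _ _ (c * c' * (n%:R * 4^-1 ^+ n) + c * c' * 4^-1 ^+ n)).
    apply: lerD.
      rewrite (le_trans (normc_sum _ _ _)) //.
      apply: (@le_trans _ _ (\sum_(i < n) c * c' * 4^-1 ^+ n)); last first.
        by rewrite sumr_const card_ord -mulr_natl le_eqVlt; apply/orP; left; apply/eqP;
          ring.
      apply: ler_sum => i _; rewrite normcM.
      have -> : c * c' * 4^-1 ^+ n = (c * 4^-1 ^+ i) * (c' * 4^-1 ^+ (n - i)).
        by rewrite -{1}(subnKC (ltnW (ltn_ord i))) exprD; ring.
      apply: ler_pM; rewrite ?normc_ge0 //.
        rewrite normcM normcX.
        apply: (@le_trans _ _ (c * k ^+ i * normc u ^+ i)).
          by rewrite ler_wpM2r ?exprn_ge0 ?normc_ge0.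
        by rewrite -mulrA -exprMn ler_wpM2l // q4.
      by apply: (le_trans (H' _ _ vr)); rewrite ler_wpM2l // q4.
    rewrite normcM mulrAC; apply: ler_pM; rewrite ?normc_ge0 //.
    by apply: (le_trans (H _ _ ur)); rewrite ler_wpM2l // q4.
  rewrite -mulrDr ler_wpM2l ?mulr_ge0 //.
  have -> : n%:R * 4^-1 ^+ n + 4^-1 ^+ n = n.+1%:R * 4^-1 ^+ n :> R by rewrite -natr1; ring.
  have -> : 4^-1 = 2^-1 * 2^-1 :> R by rewrite -invfM -natrM.
  rewrite exprMn mulrA ler_piMl ?exprn_ge0 ?invr_ge0 //.
  rewrite exprVn ler_pdivrMr ?exprn_gt0 // mul1r -natrX ler_nat.
  exact: ltn_expl.
apply/cvg_normcP => e e0; have [N HN] := expr_half_small (c * c') e0.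
by exists N => n /HN; apply: le_lt_trans.
Qed.

(** The lowest nonvanishing term would dominate near 0. By strong induction the terms below [i]
    vanish, and at a small real [t] the others, together with the bound, amount to at most M
    t^(i+1), so that |d_i| <= M t. *)
Lemma small_polynomial_eq0 d n (c r : R) : 0 <= c -> 0 < r ->
  (forall z, normc z < r -> normc (\sum_(i < n) d i * z ^+ i) <= c * normc z ^+ n) ->
  forall i, (i < n)%N -> d i = 0.
Proof.
move=> c0 r0 H; elim/ltn_ind => i IH lt_in.
pose M := c + \sum_(l < n) normc (d l).
have M0 : 0 <= M by rewrite addr_ge0 // sumr_ge0 // => l _; exact: normc_ge0.
apply/eqP; rewrite -normc_eq0 eq_le normc_ge0 andbT.
apply/ler_addgt0Pl => e e0; rewrite addr0.
(* [t <= 1] brings all higher powers below t^(i+1), [r / 2] keeps [t] in the disc, and the last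
   bound gives t M <= e. *)
pose t := Num.min (Num.min 1 (r / 2)) (e / (M + 1)).
have M1 : 0 < M + 1 by rewrite ltr_wpDl.
have t0 : 0 < t by rewrite !lt_min ltr01 !divr_gt0.
have t1 : t <= 1 by rewrite !ge_min lexx.
have tr : t < r.
  apply: (@le_lt_trans _ _ (r / 2)); first by rewrite !ge_min lexx orbT.
  by rewrite ltr_pdivrMr // mulr_natr mulr2n ltrDl.
have te : t * M <= e.
  apply: (@le_trans _ _ (t * (M + 1))); first by rewrite ler_wpM2l ?lerDl // ltW.
  by rewrite -ler_pdivlMr // ge_min lexx orbT.
have nt : normc t%:C = t by rewrite normc_real gtr0_norm.
have := H t%:C; rewrite nt => /(_ tr) {}H.
have ti : 0 < t ^+ i by rewrite exprn_gt0.
apply: (le_trans _ te); rewrite -(ler_pM2r ti).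
have -> : normc (d i) * t ^+ i = normc (d i * t%:C ^+ i) by rewrite normcM normcX nt.
have -> : t * M * t ^+ i = c * t ^+ i.+1 + \sum_(l < n) normc (d l) * t ^+ i.+1.
  by rewrite -mulr_suml exprS /M; ring.
rewrite (bigD1 (Ordinal lt_in)) //= in H.
set S := \sum_(l < n | l != Ordinal lt_in) _ in H.
have -> : d i * t%:C ^+ i = (d i * t%:C ^+ i + S) - S by ring.
rewrite (le_trans (normcD _ _)) // normcN; apply: lerD.
  by apply: (le_trans H); rewrite ler_wpM2l // ler_wiXn2l // ltW.
rewrite (le_trans (normc_sum _ _ _)) // [leRHS](bigD1 (Ordinal lt_in)) //=.
apply: ler_wpDl; first by rewrite mulr_ge0 ?normc_ge0 ?exprn_ge0 // ltW.
apply: ler_sum => l li; rewrite normcM normcX nt.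
have [li'|il] := ltnP l i.
  by rewrite IH // normc0 !mul0r.
rewrite ler_wpM2l ?normc_ge0 // ler_wiXn2l ?(ltW t0) ?t1 // ltn_neqAle il andbT.
by apply: contra li => /eqP e1; apply/eqP/val_inj.
Qed.

Lemma geometric_sum_le (x : R) n : 0 <= x -> x <= 2^-1 -> \sum_(i < n) x ^+ i <= 2.
Proof.
move=> x0 x2; have h : 0 < 1 - x by lra.
have := subrX1 x n => /eqP; rewrite -opprB -[x - 1]opprB mulNr eqr_opp => /eqP e.
rewrite -(ler_pM2l h) -e; have := exprn_ge0 n x0; lra.
Qed.

(** Convergence at p = r / 2 bounds the terms d_i p^i, so for |z| < p / 2 the tail from index n on
    is O(|z|^n). The sum being 0, the initial segment is O(|z|^n) as well and [small_polynomial_eq0]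
    applies. *)
Lemma null_power_series d (r : R) : 0 < r ->
  (forall z : C, normc z < r -> series (fun j => d j * z ^+ j : C) @ \oo --> (0 : C)) ->
  forall j, d j = 0.
Proof.
move=> r0 H j.
pose p := r / 2; have p0 : 0 < p by rewrite divr_gt0.
have pr : p < r by rewrite ltr_pdivrMr // mulr_natr mulr2n ltrDl.
have np : normc p%:C = p by rewrite normc_real gtr0_norm.
have [B B0 HB] : exists2 B : R, 0 <= B & forall i, normc (d i) * p ^+ i <= B.
  have := H p%:C; rewrite np => /(_ pr)/cvg_normcP/(_ 1 ltr01)[N HN].
  have sum0 : 0 <= \sum_(i < N) normc (d i) * p ^+ i.
    by apply: sumr_ge0 => i _; rewrite mulr_ge0 ?normc_ge0 ?exprn_ge0 // ltW.
  (* From [N] on the partial sums are within 1 of the limit 0, so consecutive ones differ by at most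
     2; the sum covers the earlier terms. *)
  exists (2 + \sum_(i < N) normc (d i) * p ^+ i) => [|i]; first by rewrite addr_ge0.
  have [iN|Ni] := ltnP i N.
    rewrite (bigD1 (Ordinal iN)) //= addrCA lerDl addr_ge0 // sumr_ge0 // => l _.
    by rewrite mulr_ge0 ?normc_ge0 ?exprn_ge0 // ltW.
  apply: (@le_trans _ _ 2); last by rewrite lerDl.
  have -> : normc (d i) * p ^+ i = normc (d i * p%:C ^+ i) by rewrite normcM normcX np.
  have h1 := HN i Ni; have h2 := HN i.+1 (leqW Ni).
  rewrite !subr0 in h1 h2.
  have -> : d i * p%:C ^+ i = series (fun j => d j * p%:C ^+ j : C) i.+1 -
      series (fun j => d j * p%:C ^+ j : C) i.
    by rewrite /series /= big_nat_recr //=; ring.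
  by rewrite (le_trans (normcD _ _)) // normcN ltW // ltrD.
have p2 : 0 < p / 2 by rewrite divr_gt0.
(* The factor 2 bounds the geometric series of ratio |z| / p <= 1 / 2. *)
apply: (@small_polynomial_eq0 d j.+1 (B * 2 * p^-1 ^+ j.+1) (p / 2)) => //.
  by rewrite !mulr_ge0 ?exprn_ge0 ?invr_ge0 // ltW.
move=> z zp; set n := j.+1.
have zr : normc z < r by apply: lt_trans pr; apply: (lt_trans zp);
  rewrite ltr_pdivrMr // mulr_natr mulr2n ltrDl.
apply/ler_addgt0Pl => e e0; have /cvg_normcP/(_ e e0)[N HN] := H z zr.
have := HN (n + N)%N (leq_addl _ _); rewrite subr0 /series /= => h.
rewrite (@big_cat_nat _ _ _ n) ?leq_addr //= big_mkord in h.
set S := \sum_(i < n) _ in h *; set T := \sum_(_ <= _ < _) _ in h.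
have -> : S = (S + T) - T by ring.
rewrite (le_trans (normcD _ _)) // normcN; apply: lerD; first exact: ltW.
rewrite /T -{1}[n]add0n big_addn addKn big_mkord (le_trans (normc_sum _ _ _)) //.
pose x := normc z / p.
have x0 : 0 <= x by rewrite divr_ge0 ?normc_ge0 // ltW.
have x2 : x <= 2^-1 by rewrite ler_pdivrMr // mulrC ltW.
have -> : B * 2 * p^-1 ^+ n * normc z ^+ n = B * x ^+ n * 2.
  by rewrite /x exprMn; ring.
apply: (@le_trans _ _ (\sum_(i < N) B * x ^+ n * x ^+ i)).
  apply: ler_sum => i _; rewrite normcM normcX -mulrA -exprD addnC /x expr_div_n.
  set m := (n + i)%N.
  have pm : 0 < p ^+ m by rewrite exprn_gt0.
  rewrite mulrA mulrAC ler_wpM2r ?exprn_ge0 ?normc_ge0 //.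
  by rewrite ler_pdivlMr.
by rewrite -mulr_sumr ler_wpM2l ?mulr_ge0 ?exprn_ge0 // geometric_sum_le.
Qed.

(** In characteristic 0 the naturals give a nonzero difference more roots than its degree allows. *)
Lemma eq_horner_poly (p q : {poly R[i]}) : (forall x, p.[x] = q.[x]) -> p = q.
Proof.
move=> pq; apply/eqP; rewrite -subr_eq0; apply: contraT => nz.
have /(max_poly_roots nz) : all (root (p - q)) [seq (i%:R : R[i]) | i <- iota 0 (size
  (p - q))].
  by apply/allP => _ /mapP[i _ ->]; rewrite rootE !hornerE pq subrr.
rewrite size_map size_iota ltnn map_inj_uniq ?iota_uniq; first by apply.
by move=> i j /eqP; rewrite eqr_nat => /eqP.
Qed.

(** For each fixed tau the slice is a power series in z, convergent in a disc depending on tau; its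
    coefficients are the values of the polynomials at tau. *)
Lemma is_expansion_unique (G : C * C -> C) P Q :
  is_expansion G P -> is_expansion G Q -> P = Q.
Proof.
move=> hP hQ; apply/funext => j; apply: eq_horner_poly => tau.
have [r r0 hr] := (nbhs_normc2P _ 0 tau).1 (filterI (hP tau) (hQ tau)).
apply/eqP; rewrite -subr_eq0; apply/eqP.
apply: (@null_power_series (fun j => (P j).[tau] - (Q j).[tau]) r r0 _ j) => z zr.
have z1 : normc ((z, tau).1 - 0) < r by rewrite subr0.
have z2 : normc ((z, tau).2 - tau) < r by rewrite subrr normc0.
have [h1 h2] := hr (z, tau) z1 z2.
rewrite -(subrr (G (z, tau))).
rewrite (_ : series _ = (fun n => series (fun j => (P j).[tau] * z ^+ j : C) n -
   series (fun j => (Q j).[tau] * z ^+ j : C) n)); last first.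
  apply/funext => n; rewrite /series /= -sumrB.
  by apply: eq_bigr => i _; rewrite mulrBl.
exact: (cvgB h1 h2).
Qed.

Lemma is_expansion_lin (c : R[i]) (G H : C * C -> C) P Q :
  is_expansion G P -> is_expansion H Q ->
  is_expansion (c *: G + H) (fun j => c *: P j + Q j).
Proof.
move=> hP hQ tau; apply: filterS2 (hP tau) (hQ tau) => p h1 h2.
rewrite -[(c *: G + H) p]/(c * G p + H p : C).
rewrite (_ : series _ = (fun n => c * series (fun j => (P j).[p.2] * p.1 ^+ j : C) n +
   series (fun j => (Q j).[p.2] * p.1 ^+ j : C) n)); last first.
  apply/funext => n; rewrite /series /= mulr_sumr -big_split /=.
  by apply: eq_bigr => i _; rewrite hornerD hornerZ mulrDl -mulrA.
exact: (cvgD (cvgM (cvg_cst (c : C)) h1) h2).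
Qed.

Lemma is_expansion0 : is_expansion (0 : C * C -> C) (fun=> 0).
Proof.
move=> tau; apply/nbhs_normc2P; exists 1 => // p _ _.
have -> : series (fun j => (0 : {poly R[i]}).[p.2] * p.1 ^+ j : C) = (fun=> 0).
  by apply/funext => n; rewrite /series /= big1 // => i _; rewrite horner0 mul0r.
exact: cvg_cst.
Qed.

Lemma is_expansion_taylor f g a b : has_taylor f a -> has_taylor g b ->
  is_expansion (fun p => g p.1 * f (p.1 * p.2))
    (fun j => \poly_(i < j.+1) (a i * b (j - i)%N)).
Proof.
move=> hf hg tau; have [r r0 H] := taylor_product hf hg.
have T0 : 0 < normc tau + 1 by rewrite ltr_wpDl ?normc_ge0.
(* Within distance 1 of tau the second variable has norm at most |tau| + 1, so both z and z times
   that variable lie in the disc of [taylor_product]. *)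
apply/nbhs_normc2P; exists (Num.min 1 (Num.min r (r / (normc tau + 1)))).
  by rewrite !lt_min ltr01 r0 divr_gt0.
move=> [z w] /=; rewrite subr0 !lt_min => /andP[_ /andP[zr zt]] /andP[w1 _].
have zw : normc (z * w) < r.
  have wt : normc w <= normc tau + 1.
    have -> : w = tau + (w - tau) by ring.
    by rewrite (le_trans (normcD _ _)) // lerD2l ltW.
  rewrite normcM; apply: (@le_lt_trans _ _ (normc z * (normc tau + 1))).
    by rewrite ler_wpM2l ?normc_ge0.
  by rewrite -ltr_pdivlMr.
rewrite (mulrC (g z)) (_ : series _ = series (fun j => \sum_(i < j.+1)
   (a i * (z * w) ^+ i) * (b (j - i)%N * z ^+ (j - i)) : C)); first exact: H.
congr series; apply/funext => j; rewrite horner_poly mulr_suml; apply: eq_bigr => i _.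
have zj : z ^+ j = z ^+ i * z ^+ (j - i) by rewrite -exprD subnKC // -ltnS.
by rewrite zj exprMn /=; ring.
Qed.

End PowerSeries.

(** * Vanishing order and Taylor coefficients *)

Section TaylorOrder.
Variable R : realType.

Local Notation C := (R[i]^o).
Local Notation normc := (@Normc.normc R).
Implicit Types (f g : C -> C) (a b : nat -> R[i]).

Lemma eq_has_taylor f g a b : f =1 g -> a =1 b -> has_taylor f a -> has_taylor g b.
Proof. by move=> /funext -> /funext ->. Qed.

Lemma has_taylor_lin (x : R[i]) f g a b : has_taylor f a -> has_taylor g b ->
  has_taylor (fun z => x * f z + g z) (fun i => x * a i + b i).
Proof.
move=> [c [k [r [c0 k0 r0 H]]]] [c' [k' [r' [c'0 k'0 r'0 H']]]].
exists (normc x * c + c'), (Num.max k k'), (Num.min r r'); split.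
- by rewrite addr_ge0 // mulr_ge0 ?normc_ge0.
- by rewrite lt_max k0.
- by rewrite lt_min r0.
move=> n z; rewrite lt_min => /andP[zr zr'].
have mono (h : R) : 0 < h -> h <= Num.max k k' ->
    (h * normc z) ^+ n <= (Num.max k k' * normc z) ^+ n.
  move=> h0 hk; have ? := normc_ge0 z; rewrite lerXn2r ?nnegrE ?mulr_ge0 ?(ltW h0) //.
    by rewrite (le_trans (ltW h0)).
  by rewrite ler_wpM2r.
have -> : x * f z + g z - \sum_(i < n) (x * a i + b i) * z ^+ i =
  x * (f z - \sum_(i < n) a i * z ^+ i) + (g z - \sum_(i < n) b i * z ^+ i).
  rewrite mulrBr mulr_sumr (eq_bigr (fun i : 'I_n => x * (a i * z ^+ i) + b i * z ^+ i)).
    by rewrite big_split /=; ring.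
  by move=> i _; rewrite mulrDl mulrA.
rewrite (le_trans (normcD _ _)) // [leRHS]mulrDl; apply: lerD.
  rewrite normcM -mulrA ler_wpM2l ?normc_ge0 // (le_trans (H _ _ zr)) // ler_wpM2l //.
  by apply: mono; rewrite // le_max lexx.
rewrite (le_trans (H' _ _ zr')) // ler_wpM2l //.
by apply: mono; rewrite // le_max lexx orbT.
Qed.

Lemma has_taylor_expr m : has_taylor (fun z : C => z ^+ m) (fun i => (i == m)%:R).
Proof.
exists 1, 1, 1; split=> // n z z1.
have [mn|nm] := ltnP m n.
  rewrite (bigD1 (Ordinal mn)) //= eqxx [true%:R * _]mul1r big1 ?addr0 ?subrr ?normc0.
    by rewrite !mul1r exprn_ge0 // normc_ge0.
  move=> i im; rewrite (_ : (i == m :> nat) = false) ?mul0r //.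
  by apply: contraNF im => /eqP e; apply/eqP/val_inj.
rewrite big1 ?subr0 ?mul1r; first by rewrite normcX ler_wiXn2l ?normc_ge0 // ltW.
move=> i _; rewrite (_ : (i == m :> nat) = false) ?mul0r //.
by rewrite ltn_eqF // (leq_trans _ nm).
Qed.

(** The Taylor polynomial is [f] minus its remainder, and both are O(|z|^n). *)
Lemma taylor_coef_eq0 f a n (c r : R) : has_taylor f a -> 0 < r ->
  (forall z, normc z < r -> normc (f z) <= c * normc z ^+ n) ->
  forall i, (i < n)%N -> a i = 0.
Proof.
move=> [c' [k [r' [c'0 k0 r'0 H]]]] r0 fn.
apply: (@small_polynomial_eq0 _ a n (`|c| + c' * k ^+ n) (Num.min r r')).
- by rewrite addr_ge0 // mulr_ge0 // exprn_ge0 // ltW.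
- by rewrite lt_min r0.
move=> z; rewrite lt_min => /andP[zr zr'].
have -> : \sum_(i < n) a i * z ^+ i = f z - (f z - \sum_(i < n) a i * z ^+ i) by ring.
rewrite (le_trans (normcD _ _)) // normcN mulrDl; apply: lerD.
  by rewrite (le_trans (fn _ zr)) // ler_wpM2r ?exprn_ge0 ?normc_ge0 // ler_norm.
by rewrite (le_trans (H _ _ zr')) // exprMn mulrA.
Qed.

Lemma has_taylor_value f a : has_taylor f a -> f 0 = a 0%N.
Proof.
move=> [c [k [r [c0 k0 r0 H]]]]; apply/eqP; rewrite -subr_eq0 -normc_eq0 eq_le
  normc_ge0 andbT.
have := H 1%N 0; rewrite normc0 big_ord1 expr0 mulr1 mulr0 expr1 mulr0; exact.
Qed.

(** The quotient f(z) / z^l, completed by a_l at 0. Dividing the remainder of order l + 2 by z^l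
    leaves O(z^2), so a_(l+1) is its derivative at 0. *)
Lemma taylor_factor f a l (r0 : R) : 0 < r0 ->
  (forall z : C, normc z < r0 -> derivable f z 1) -> has_taylor f a ->
  (forall i, (i < l)%N -> a i = 0) ->
  exists g : C -> C, (\forall z \near (0 : C), derivable g z 1) /\
    (\forall z \near (0 : C), f z = z ^+ l * g z).
Proof.
move=> r0_gt0 df fa al; exists (fun z => if z == 0 then a l else f z / z ^+ l); split.
  apply/nbhs_normcP; exists r0 => // z; rewrite subr0 => zr.
  have [->{z zr}|z0] := eqVneq z 0.
    apply/has_cderivP; exists (a l.+1) => e e0.
    move: fa => [c [k [r [c0 k0 r_0 H]]]].
    exists (Num.min r (e / (c * k ^+ l.+2 + 1))).
      by rewrite lt_min r_0 divr_gt0 // ltr_wpDl // mulr_ge0 // exprn_ge0 // ltW.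
    move=> w; rewrite subr0 lt_min eqxx => /andP[wr we]; case: eqVneq => [->|w0].
      by rewrite mulr0 !subrr normc0 mulr0.
    have wl : w ^+ l != 0 by rewrite expf_neq0.
    have nw : 0 < normc w ^+ l by rewrite exprn_gt0 // normc_gt0.
    rewrite -(ler_pM2r nw) -normcX -normcM.
    have -> : (f w / w ^+ l - a l - a l.+1 * w) * w ^+ l =
        f w - \sum_(i < l.+2) a i * w ^+ i.
      rewrite !big_ord_recr /= big1 ?add0r; last by move=> i _; rewrite al ?mul0r.
      by rewrite exprS; field.
    apply: (le_trans (H _ _ wr)); rewrite exprMn mulrA normcX.
    set K := c * k ^+ l.+2 in we *; have K0 : 0 <= K by rewrite mulr_ge0 // exprn_ge0
      // ltW.
    have Ke : K * normc w <= e.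
      apply: (@le_trans _ _ ((K + 1) * normc w));
        first by rewrite ler_wpM2r ?normc_ge0 ?lerDl.
      by rewrite mulrC -ler_pdivlMr ?(ltW we) // ltr_wpDl.
    have -> : K * normc w ^+ l.+2 = K * normc w * (normc w * normc w ^+ l) by rewrite
      !exprS; ring.
    by rewrite -[leRHS]mulrA ler_wpM2r // mulr_ge0 ?exprn_ge0 ?normc_ge0.
  apply: (@near_eq_derivable _ _ _ (fun z => f z / z ^+ l)).
    apply/nbhs_normcP; exists (normc z); first by rewrite normc_gt0.
    move=> w wz; case: eqVneq => // w0; move: wz.
    by rewrite w0 sub0r normcN ltxx.
  apply: derivableM; first exact: df.
  apply: derivableV; first by rewrite expf_neq0.
  exact: exprn_derivable.
apply/nbhs_normcP; exists 1 => // z _; case: eqVneq => [->|z0].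
  rewrite (has_taylor_value fa); case: l al => [_|l ->] //.
    by rewrite expr0 mul1r.
  by rewrite expr0n mul0r.
by rewrite mulrC divfK // expf_neq0.
Qed.

End TaylorOrder.

(** * Weak functions and meromorphy *)

Section WeakFunctionFacts.
Variables (R : realType) (N : nat).
Hypothesis N0 : (0 < N)%N.

Local Notation C := (R[i]^o).
Local Notation normc := (@Normc.normc R).

Let N0R : 0 < N%:R :> R. Proof. by rewrite ltr0n. Qed.

Lemma normc_nat n : normc n%:R = n%:R.
Proof. by rewrite -[n%:R](rmorph_nat (real_complex R)) normc_real normr_nat. Qed.

Lemma fraction_separated (p q : C) : fraction N p -> fraction N q -> p != q ->
  N%:R^-1 <= normc (p - q).
Proof.
move=> [j ->] [k ->] pq; rewrite -mulrBl normcM normcV normc_nat.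
rewrite ler_peMl ?invr_ge0 ?(ltW N0R) //.
have -> : j%:~R - k%:~R = (j - k)%:~R :> R[i] by rewrite rmorphB.
have jk : j - k != 0 by apply: contraNneq pq => /subr0_eq ->.
have -> : (j - k)%:~R = ((j - k)%:~R : R)%:C :> R[i] by rewrite rmorph_int.
rewrite normc_real -intr_norm ler1z.
by move: jk; case: (j - k) => [[|n]|n].
Qed.

(** Here [p] is arbitrary: two distinct points of (1/N)Z cannot both be within 1 / (2 N) of it, so
    at most one has to be avoided. *)
Lemma near_not_fraction (p : C) :
  \forall z \near p, fraction N z -> z = p.
Proof.
have i0 : 0 < (N%:R^-1 / 2 : R) by rewrite divr_gt0 ?invr_gt0.
have [[q [qN qp qd]]|none] := pselect (exists q : C, [/\ fraction N q, q != p &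
    normc (q - p) < N%:R^-1 / 2]).
  apply/nbhs_normcP; exists (Num.min (N%:R^-1 / 2) (normc (q - p))).
    by rewrite lt_min i0 normc_gt0 subr_eq0.
  move=> z; rewrite lt_min => /andP[h1 h2] zN.
  have [zq|zq] := eqVneq z q; first by rewrite zq ltxx in h2.
  have := fraction_separated zN qN zq; rewrite leNgt.
  rewrite (le_lt_trans (normc_distD z p q)) // [ltRHS]splitr ltrD // normcB //.
apply/nbhs_normcP; exists (N%:R^-1 / 2) => // z h zN.
by apply: contrapT => /eqP zp; apply: none; exists z.
Qed.

(** Extended from fractions to all points, so that [J0_meromorphic] can multiply by z - p everywhere
    without case distinction. *)
Lemma weak0_simple_pole (w : weak0Type R N) p : at_most_simple_pole w p.
Proof.
have /set_mem[[_ dw pw _] _ _] := weak0_funP w.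
have [pN|pN] := pselect (fraction N p); first exact: pw.
exists (fun z => (z - p) * w z); split; last first.
  by apply/dnbhs_normcP; exists 1.
apply: filterS (near_not_fraction p) => z zp.
apply: derivableM; first exact: derivable_sub_cst.
by apply: dw => zN; apply: pN; rewrite -(zp zN).
Qed.

Lemma weak0_derivable (w : weak0Type R N) (z : C) :
  normc z < N%:R^-1 -> derivable w z 1.
Proof.
have /set_mem[[_ dw _ _] d0 _] := weak0_funP w.
move=> zN; have [->|z0] := eqVneq z 0; first exact: d0.
apply: dw => zf; have f0 : fraction N (0 : C) by exists 0; rewrite mul0r.
by have := fraction_separated zf f0 z0; rewrite subr0 leNgt zN.
Qed.

Lemma weak0_taylor (w : weak0Type R N) : exists a, has_taylor w a.
Proof.
apply: (@derivable_taylor _ _ N%:R^-1); first by rewrite invr_gt0.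
exact: weak0_derivable.
Qed.

End WeakFunctionFacts.

Section Spans.
Variable K : fieldType.

Lemma lspan_ind (U : lmodType K) (S : set U) (P : U -> Prop) :
  P 0 -> (forall a u v, S u -> P v -> P (a *: u + v)) -> forall u, lspan S u -> P u.
Proof.
move=> P0 PS _ [n [a [s [Ss ->]]]]; elim/big_rec: _ => [//|i v _ Pv].
exact: PS.
Qed.

Lemma lspan0 (U : lmodType K) (S : set U) : lspan S 0.
Proof. by exists 0%N, (fun=> 0), (fun=> 0); split=> [[]//|]; rewrite big_ord0. Qed.

Lemma lspan_scaleD (U : lmodType K) (S : set U) a u v :
  S u -> lspan S v -> lspan S (a *: u + v).
Proof.
move=> Su [n [b [s [Ss ->]]]].
exists n.+1, (fun i => oapp b a (unlift ord0 i)), (fun i => oapp s u (unlift ord0 i)).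
split; first by move=> i; case: unliftP => [j|] _ /=; [exact: Ss|exact: Su].
rewrite big_ord_recl /= unlift_none /=; congr (_ + _).
by apply: eq_bigr => i _; rewrite liftK.
Qed.

Lemma basis_coord (U : lmodType K) n (e : 'I_n -> U) : is_basis e ->
  forall u, exists x : 'I_n -> K, u = \sum_i x i *: e i.
Proof.
move=> [_ full] u; have : lspan (range e) u by rewrite full.
move: u; apply: (@lspan_ind U _ (fun u => exists x : 'I_n -> K, u = \sum_i x i *: e i))
  => [|a _ _ [j _ <-] [x ->]].
  by exists (fun=> 0); rewrite big1 // => i _; rewrite scale0r.
exists (fun i => a *+ (i == j) + x i).
transitivity (\sum_i ((a *+ (i == j)) *: e i + x i *: e i)); last first.
  by apply: eq_bigr => i _; rewrite scalerDl.
rewrite [RHS]big_split /=; congr (_ + _).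
rewrite (bigD1 j) //= eqxx mulr1n big1 ?addr0 // => i /negbTE ->.
by rewrite mulr0n scale0r.
Qed.

End Spans.

Section Meromorphy.
Variable R : realType.

Local Notation C := (R[i]^o).
Local Notation normc := (@Normc.normc R).
Implicit Types (G H : C * C -> C).

(* Keeping the denominator [g] fixed makes the quotients closed under linear
   combinations. *)
Definition quotient_near (g : C * C -> C) (p : C * C) : set (C * C -> C) :=
  [set G | exists2 f : C * C -> C, \forall q \near p, differentiable f q &
     \forall q \near p, g q != 0 -> G q = f q / g q].

Lemma quotient_near_lin g p (a : R[i]) G H :
  quotient_near g p G -> quotient_near g p H -> quotient_near g p (a *: G + H).
Proof.
move=> [f df Gf] [h dh Hh]; exists (fun q => a * f q + h q).
  apply: filterS2 df dh => q df dh; apply: differentiableD => //.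
  by apply: differentiableM => //; exact: differentiable_cst.
apply: filterS2 Gf Hh => q Gf Hh g0.
by rewrite -[LHS]/(a * G q + H q) Gf // Hh // mulrDl mulrA.
Qed.

Lemma quotient_near0 g p : quotient_near g p 0.
Proof.
by exists (fun=> 0 : C); case: p => z w; apply/nbhs_normc2P; exists 1 => // q _ _;
  rewrite ?mul0r //; exact: differentiable_cst.
Qed.

Lemma near_proj1 (P : set C) (p : C * C) : (\forall z \near p.1, P z) ->
  \forall q \near p, P q.1.
Proof.
case: p => z w /= /nbhs_normcP[d d0 H]; apply/nbhs_normc2P; exists d => // q h _.
exact: H.
Qed.

Lemma near_proj2 (P : set C) (p : C * C) : (\forall z \near p.2, P z) ->
  \forall q \near p, P q.2.
Proof.
case: p => z w /= /nbhs_normcP[d d0 H]; apply/nbhs_normc2P; exists d => // q _ h.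
exact: H.
Qed.

Lemma differentiable_proj1 (p : C * C) : differentiable (fun q : C * C => q.1) p.
Proof.
by apply: (@linear_differentiable _ _ _ (@fst C C)) => q P; exact: near_proj1.
Qed.

Lemma differentiable_proj2 (p : C * C) : differentiable (fun q : C * C => q.2) p.
Proof.
by apply: (@linear_differentiable _ _ _ (@snd C C)) => q P; exact: near_proj2.
Qed.

Lemma near_prod12 (P : set C) (p : C * C) : (\forall z \near p.1 * p.2, P z) ->
  \forall q \near p, P (q.1 * q.2).
Proof.
move=> H; have := differentiable_continuous (differentiableM (differentiable_proj1 p)
  (differentiable_proj2 p)).
by move/(_ _ H).
Qed.

(** The first factor of [g] clears the possible pole of w(z tau), the second that of eta(z). As [g]
    depends on the point only, linear combinations keep it as denominator. *)
Lemma J0_meromorphic (M N : nat) G : (0 < M)%N -> (0 < N)%N ->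
  J0 M N G -> meromorphic2 G.
Proof.
move=> M0 N0 JG p.
pose g (q : C * C) : C := (q.1 * q.2 - p.1 * p.2) * (q.1 - p.1).
have dg q : differentiable g q.
  have d1 := differentiable_proj1 q; have d2 := differentiable_proj2 q.
  apply: differentiableM.
    by apply: differentiableB; [exact: differentiableM|exact: differentiable_cst].
  by apply: differentiableB => //; exact: differentiable_cst.
suff [f df fg] : quotient_near g p G.
  exists f, g; split => //.
  - by apply: filterS df => q; split.
  - case: p @g {dg fg df} => z w g /nbhs_normc2P[d d0 H].
    have n1 : 0 < normc (z + w) + d by rewrite ltr_wpDl ?normc_ge0.
    (* Along the diagonal (z + t, w + t) the denominator is t^2 (z + w + t); of the two values d / 2
       and d / 3 at least one avoids its zeros. *)
    have [t [t0 td tzw]] : exists t : R, [/\ t != 0, `|t| < d & z + w + t%:C != 0].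
      have [e|ne] := eqVneq (z + w + (d / 2)%:C) 0.
        exists (d / 3); split.
        - by rewrite gt_eqF // divr_gt0.
        - by rewrite gtr0_norm ?divr_gt0 // ltr_pdivrMr //; lra.
        - apply/eqP => e2; have /complexI : (d / 2)%:C = (d / 3)%:C.
            by apply: (addrI (z + w)); rewrite e e2.
          by lra.
      exists (d / 2); split=> //.
      - by rewrite gt_eqF // divr_gt0.
      - by rewrite gtr0_norm ?divr_gt0 // ltr_pdivrMr //; lra.
    have nt : normc t%:C < d by rewrite normc_real.
    have := H (z + t%:C, w + t%:C); rewrite /= addrAC subrr add0r addrAC subrr add0r.
    move=> /(_ nt nt) /eqP; rewrite /g /= addrAC subrr add0r mulf_eq0.
    have tC0 : t%:C != 0 by rewrite -normc_eq0 normc_real normr_eq0.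
    rewrite (negbTE tC0) orbF.
    have -> : (z + t%:C) * (w + t%:C) - z * w = t%:C * (z + w + t%:C) by ring.
    by rewrite mulf_eq0 (negbTE tC0) (negbTE tzw).
apply: (lspan_ind _ _ JG); first exact: quotient_near0.
move=> a _ v [w _ [eta _ <-]] qv; apply: quotient_near_lin qv.
have [h [dh hw]] := weak0_simple_pole M0 w (p.1 * p.2).
have [k [dk ke]] := weak0_simple_pole N0 eta p.1.
exists (fun q => h (q.1 * q.2) * k q.1).
  apply: filterS2 (near_prod12 dh) (near_proj1 dk) => q dhq dkq.
  have d1 := differentiable_proj1 q; have d2 := differentiable_proj2 q.
  apply: differentiableM.
    apply: (@differentiable_comp _ _ _ _ (fun q : C * C => q.1 * q.2 : C) h).
      exact: differentiableM.
    exact: ((derivable1_diffP h (q.1 * q.2)).1 dhq).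
  apply: (@differentiable_comp _ _ _ _ (fun q : C * C => q.1) k); first exact: d1.
  exact: ((derivable1_diffP k q.1).1 dkq).
move: hw ke; rewrite !near_withinE => /near_prod12 hw /near_proj1 ke.
apply: filterS2 hw ke => q hw ke gq0; rewrite /jacobi_product.
have g1 : q.1 * q.2 - p.1 * p.2 != 0 by apply: contraNneq gq0; rewrite /g => ->;
  rewrite mul0r.
have g2 : q.1 - p.1 != 0 by apply: contraNneq gq0; rewrite /g => ->; rewrite mulr0.
have e1 := hw (etrans (esym (congr1 negb (subr_eq0 _ _))) g1).
have e2 := ke (etrans (esym (congr1 negb (subr_eq0 _ _))) g2).
rewrite -e1 -e2 /g; move: g1 g2; set A := _ - _; set B := q.1 - _; move=> A0 B0.
by field; rewrite A0 B0.
Qed.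

End Meromorphy.

(** * Orders of expansions *)

Section Degrees.
Variable R : realType.

Local Notation C := (R[i]^o).
Implicit Types (P : {poly R[i]}) (g : nat -> nat -> R[i]).

Lemma codeg0 j : @codeg R j 0 = +oo%E.
Proof. by rewrite /codeg /edeg eqxx. Qed.

Lemma codegE j P : P != 0 -> (size P <= j.+1)%N ->
  @codeg R j P = ((j - (size P).-1)%N%:R)%:E.
Proof.
move=> P0 sP; rewrite /codeg /edeg (negbTE P0) -EFinB natrB //.
by move: sP; case: (size P).
Qed.

Lemma edeg_le j P : (size P <= j.+1)%N -> (@edeg R P <= (j%:R)%:E)%E.
Proof.
rewrite /edeg; case: eqP => _ sP; first exact: leNye.
by rewrite lee_fin ler_nat; move: sP; case: (size P).
Qed.

Lemma codeg_ge j mu P : (size P <= j.+1)%N ->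
  ((mu%:R)%:E <= @codeg R j P)%E <->
  (forall i, (i <= j)%N -> (j - i < mu)%N -> P`_i = 0).
Proof.
move=> sP; have [->|P0] := eqVneq P 0.
  by rewrite codeg0 leey; split => // _ i _ _; rewrite coef0.
rewrite codegE // lee_fin ler_nat.
have sP0 : (0 < size P)%N by rewrite size_poly_gt0.
split=> [h i ij im|h].
  apply: nth_default; move: sP sP0 h; move: (size P) => s; lia.
rewrite leqNgt; apply/negP => lt_mu; move: P0; rewrite -lead_coef_eq0 lead_coefE.
by rewrite h ?eqxx //; lia.
Qed.

(* The coefficient of [z ^ j] in the double series of terms
   [g i k * (z * tau) ^ i * z ^ k]. *)
Definition diag_poly g j : {poly R[i]} := \poly_(i < j.+1) g i (j - i)%N.

Lemma coef_diag_poly g j i : (i <= j)%N -> (diag_poly g j)`_i = g i (j - i)%N.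
Proof. by move=> ij; rewrite coef_poly ltnS ij. Qed.

Lemma size_diag_poly g j : (size (diag_poly g j) <= j.+1)%N.
Proof. exact: size_poly. Qed.

(** Flipping transposes the double series, so whatever is shown for degrees in the second index
    carries over to the first. *)
Lemma poly_flip_diag g j :
  poly_flip j (diag_poly g j) = diag_poly (fun i k => g k i) j.
Proof.
apply/polyP => i; rewrite !coef_poly; case: ltnP => // ij.
by rewrite ltnS leq_subr subKn.
Qed.

Lemma diag_poly_codeg_ge g mu :
  (forall j, ((mu%:R)%:E <= @codeg R j (diag_poly g j))%E) <->
  (forall i k, (k < mu)%N -> g i k = 0).
Proof.
split=> [h i k kmu|h j].
  have := (codeg_ge mu (size_diag_poly g (i + k))).1 (h (i + k)%N) i (leq_addr _ _).
  by rewrite coef_diag_poly ?leq_addr // addKn; exact.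
apply/(codeg_ge mu (size_diag_poly g j)) => i ij jmu.
by rewrite coef_diag_poly // h.
Qed.

(** The codegree of a nonzero [diag_poly g j] is the least k with g_(j-k),k nonzero. [S] is meant to
    be the projected support of the coefficients c: it is attained by [g], and every index in the
    support of [g] lies above some element of it. For an empty support both sides are infinite. *)
Lemma ereal_inf_codeg g (n : nat) (S : set 'I_n) :
  (forall k, S k -> exists i, g i k != 0) ->
  (forall i k, g i k != 0 -> exists2 l, S l & (l <= k)%N) ->
  ereal_inf (range (fun j => @codeg R j (diag_poly g j))) =
  ereal_inf [set ((k : nat)%:R)%:E | k in S].
Proof.
move=> h1 h2; apply/eqP; rewrite eq_le; apply/andP; split.
  apply: le_ereal_inf_tmp => _ [k /h1[i gik] <-].
  apply: ge_ereal_inf; exists (@codeg R (i + k) (diag_poly g (i + k)));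
    first by exists (i + k)%N.
  have nz : (diag_poly g (i + k))`_i != 0 by rewrite coef_diag_poly ?leq_addr // addKn.
  have P0 : diag_poly g (i + k) != 0 by apply: contraNneq nz => ->; rewrite coef0.
  rewrite codegE ?size_diag_poly // lee_fin ler_nat.
  have : (i < size (diag_poly g (i + k)))%N.
    by rewrite ltnNge; apply: contra nz => /leq_sizeP/(_ i (leqnn _)) ->.
  by lia.
apply: le_ereal_inf_tmp => _ [j _ <-].
have [->|P0] := eqVneq (diag_poly g j) 0; first by rewrite codeg0 leey.
have sP := size_diag_poly g j; rewrite codegE //.
have s0 : (0 < size (diag_poly g j))%N by rewrite size_poly_gt0.
set d := (size _).-1; have dj : (d <= j)%N by rewrite /d; lia.
have : g d (j - d)%N != 0 by rewrite -coef_diag_poly // -lead_coefE lead_coef_eq0.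
move=> /h2[l Sl ljd]; apply: ge_ereal_inf; exists ((l : nat)%:R)%:E; first by exists l.
by rewrite lee_fin ler_nat.
Qed.

End Degrees.

(** * Taylor coefficients of an adapted basis *)

Section AdaptedBasis.
Variables (R : realType) (N : nat) (alpha : 'I_(N - 2) -> weak0Type R N).
Hypothesis N3 : (3 <= N)%N.
Hypothesis halpha : is_adapted_basis alpha.

Local Notation C := (R[i]^o).
Local Notation normc := (@Normc.normc R).

Let N0 : (0 < N)%N. Proof. exact: leq_trans N3. Qed.

Lemma weak0_linE (a : R[i]) (u v : weak0Type R N) :
  (a *: u + v : weak0Type R N) =1 (fun z => a * u z + v z) :> (C -> C).
Proof. by move=> z. Qed.

(** The difference alpha_j - z^j is O(z^(N-2)), so its coefficients below N - 2 vanish. *)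
Lemma adapted_taylor : exists A : 'I_(N - 2) -> nat -> R[i],
  forall j, has_taylor (alpha j) (A j) /\
    forall i, (i < N - 2)%N -> A j i = (i == j)%:R.
Proof.
suff H (j : 'I_(N - 2)) : exists A : nat -> R[i], has_taylor (alpha j) A /\
    forall i, (i < N - 2)%N -> A i = (i == j)%:R.
  by have [A HA] := choice H; exists A.
have [A hA] := weak0_taylor N0 (alpha j); exists A; split=> // i iN.
have [_ /(_ j)[k /nbhs_normcP[r r0 H]] _] := halpha.
have hd := has_taylor_lin (-1) (has_taylor_expr R j) hA.
apply/eqP; rewrite -subr_eq0 addrC -mulN1r; apply/eqP.
apply: (taylor_coef_eq0 (n := N - 2) (c := k) hd r0 _ iN) => z zr.
have := H z; rewrite subr0 => /(_ zr); rewrite !norm_normc -rmorphXn -rmorphM lecR.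
by rewrite mulN1r addrC.
Qed.

Lemma taylor_sum A (x : 'I_(N - 2) -> R[i]) :
  (forall j, has_taylor (alpha j) (A j)) ->
  has_taylor (\sum_j x j *: alpha j : weak0Type R N) (fun i => \sum_j x j * A j i).
Proof.
move=> hA; suff H (s : seq 'I_(N - 2)) :
  has_taylor (\sum_(j <- s) x j *: alpha j : weak0Type R N)
    (fun i => \sum_(j <- s) x j * A j i) by exact: H.
elim: s => [|j s IH].
  exists 0, 1, 1; split=> // n z _; rewrite big_nil /= big1 ?subrr ?normc0 ?mul0r //.
  by move=> i _; rewrite big_nil mul0r.
apply: eq_has_taylor (has_taylor_lin (x j) (hA j) IH) => [z|i].
  by rewrite big_cons weak0_linE.
by rewrite big_cons.
Qed.

(** Since l <= N - 3, the Taylor coefficients of index below [l] are the coordinates themselves. A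
    function z^l g with g continuous at 0 is O(z^l), which kills them; [taylor_factor] is the
    converse. *)
Lemma weak0_ord_geP (l : nat) (x : 'I_(N - 2) -> R[i]) : (l <= N - 3)%N ->
  weak0_ord_ge l (\sum_j x j *: alpha j) <-> (forall j : 'I_(N - 2), (j < l)%N -> x j = 0).
Proof.
move=> lN; have [A hA] := adapted_taylor.
have hT := taylor_sum x (fun j => (hA j).1).
have cE i (iN : (i < N - 2)%N) : \sum_j x j * A j i = x (Ordinal iN).
  rewrite (bigD1 (Ordinal iN)) //= (hA _).2 // eqxx mulr1 big1 ?addr0 // => j ji.
  rewrite (hA _).2 // (_ : (i == j) = false) ?mulr0 //.
  by apply: contraNF ji => /eqP e; apply/eqP/val_inj.
split=> [[g [/nbhs_normcP[r r0 dg] /nbhs_normcP[r' r'0 E]]] j jl|x0].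
  have g0 : ccontinuous_at g 0.
    by apply: derivable_ccontinuous; apply: dg; rewrite subrr normc0.
  have [d d0 gd] := g0 1 ltr01.
  have := taylor_coef_eq0 (n := l) (c := normc (g 0) + 1) (r := Num.min r' d) hT.
  rewrite lt_min r'0 d0 => /(_ isT); move/(_ _ j jl).
  rewrite cE // (_ : Ordinal _ = j); last exact/val_inj.
  apply=> z; rewrite lt_min => /andP[zr zd].
  rewrite E ?subr0 // normcM normcX mulrC ler_wpM2r ?exprn_ge0 ?normc_ge0 //.
  have := gd z; rewrite subr0 => /(_ zd) h.
  by rewrite -[g z](subrK (g 0)) (le_trans (normcD _ _)) // addrC lerD2l ltW.
have NN : 0 < (N%:R^-1 : R) by rewrite invr_gt0 ltr0n.
apply: (taylor_factor NN _ hT); first exact: weak0_derivable.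
move=> i il; have iN : (i < N - 2)%N by lia.
by rewrite cE x0.
Qed.

End AdaptedBasis.

(** * The isomorphism *)

Section JacobiProduct.
Variables (R : realType) (M N : nat).

Local Notation C := (R[i]^o).

Lemma jacobi_product_is_bilinear :
  bilinear_for *:%R *:%R (@jacobi_product R M N : _ -> _ -> (C * C -> C)).
Proof.
split=> [eta a w w'|w a eta eta']; apply/funext => p.
  by rewrite /= /jacobi_product weak0_linE -[RHS]/(a * _ + _); ring.
by rewrite /= /jacobi_product weak0_linE -[RHS]/(a * _ + _); ring.
Qed.

HB.instance Definition _ := bilinear_isBilinear.Build R[i] (weak0Type R M) (weak0Type R N)
  (C * C -> C) *:%R *:%R (@jacobi_product R M N) jacobi_product_is_bilinear.

End JacobiProduct.

Section ExpansionSum.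
Variable R : realType.
Local Notation C := (R[i]^o).

Lemma is_expansion_sum (I : Type) (s : seq I) (x : I -> R[i]) (G : I -> C * C -> C)
    (g : I -> nat -> nat -> R[i]) :
  (forall i, is_expansion (G i) (diag_poly (g i))) ->
  is_expansion (\sum_(i <- s) x i *: G i)
    (diag_poly (fun a b => \sum_(i <- s) x i * g i a b)).
Proof.
move=> H; elim: s => [|i s IH].
  rewrite big_nil (_ : diag_poly _ = fun=> 0); first exact: is_expansion0.
  by apply/funext => j; apply/polyP => k; rewrite coef_poly big_nil coef0; case: ifP.
rewrite big_cons; have := is_expansion_lin (x i) (H i) IH.
congr is_expansion; apply/funext => j; apply/polyP => k.
rewrite coefD coefZ !coef_poly; case: ifP => _; last by rewrite mulr0 addr0.
by rewrite big_cons.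
Qed.

End ExpansionSum.

Section Isomorphism.
Variables (R : realType) (M N : nat).
Variables (alpha : 'I_(M - 2) -> weak0Type R M) (beta : 'I_(N - 2) -> weak0Type R N).
Hypotheses (M3 : (3 <= M)%N) (N3 : (3 <= N)%N).
Hypotheses (halpha : is_adapted_basis alpha) (hbeta : is_adapted_basis beta).
Variables (T : lmodType R[i]) (tens : {bilinear weak0Type R M -> weak0Type R N -> T}).
Local Notation C := (R[i]^o).
Variable Xi : {linear T -> (C * C -> C)}.
Hypothesis XiE : forall w eta, Xi (tens w eta) = jacobi_product w eta.

Local Notation coefs := ('I_(M - 2) -> 'I_(N - 2) -> R[i]).

Definition comb (c : coefs) : T := \sum_m \sum_n c m n *: tens (alpha m) (beta n).

Lemma comb_pair c : comb c = \sum_p c p.1 p.2 *: tens (alpha p.1) (beta p.2).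
Proof. by rewrite /comb pair_bigA. Qed.

Lemma comb0 : comb (fun _ _ => 0) = 0.
Proof. by rewrite comb_pair big1 // => p _; rewrite scale0r. Qed.

Lemma comb_lin a c d :
  comb (fun m n => a * c m n + d m n) = a *: comb c + comb d.
Proof.
rewrite !comb_pair scaler_sumr -big_split; apply: eq_bigr => p _ /=.
by rewrite scalerDl scalerA.
Qed.

Lemma eq_comb c d : (forall m n, c m n = d m n) -> comb c = comb d.
Proof. by move=> e; rewrite !comb_pair; apply: eq_bigr => p _; rewrite e. Qed.

Lemma tens_comb x y :
  tens (\sum_m x m *: alpha m) (\sum_n y n *: beta n) = comb (fun m n => x m * y n).
Proof.
rewrite linear_sumlz; apply: eq_bigr => m _; rewrite linear_sumr; apply: eq_bigr => n _.
by rewrite linearZl_LR linearZr_LR /= scalerA.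
Qed.

(** The common description of both sides: tensors by [tensor_spaceP], functions by [comb_Czt]. *)
Definition supported (l1 l2 : nat) (c : coefs) :=
  forall (m : 'I_(M - 2)) (n : 'I_(N - 2)), (m < l1)%N || (n < l2)%N -> c m n = 0.

Lemma tensor_spaceP l1 l2 F : (l1 <= M - 3)%N -> (l2 <= N - 3)%N ->
  tensor_space tens l1 l2 F <-> exists2 c, supported l1 l2 c & F = comb c.
Proof.
have [ba _ _] := halpha; have [bb _ _] := hbeta.
move=> hl1 hl2; split=> [hF|[c hc ->]].
  apply: (lspan_ind (P := fun F => exists2 c, supported l1 l2 c & F = comb c) _ _ hF).
    by exists (fun _ _ => 0) => //; rewrite comb0.
  move=> a _ _ [u hu [v hv <-]] [d hd ->].
  have [x ux] := basis_coord ba u; have [y vy] := basis_coord bb v.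
  rewrite ux vy tens_comb -comb_lin; eexists; last by [].
  rewrite ux in hu; rewrite vy in hv.
  have x0 := (weak0_ord_geP M3 halpha x hl1).1 hu.
  have y0 := (weak0_ord_geP N3 hbeta y hl2).1 hv.
  move=> m n mn; rewrite hd // addr0; case/orP: mn => [/x0 ->|/y0 ->].
    by rewrite mul0r mulr0.
  by rewrite !mulr0.
(* For the converse each basis tensor occurring in [c] must itself be a product of functions of the
   required orders. *)
have ho (n l : nat) (e : 'I_(n - 2) -> weak0Type R n) (i : 'I_(n - 2)) : (3 <= n)%N ->
    is_adapted_basis e -> (l <= n - 3)%N -> (l <= i)%N -> weak0_ord_ge l (e i).
  move=> n3 he ln li.
  have -> : e i = \sum_j (j == i)%:R *: e j.
    rewrite (bigD1 i) //= eqxx scale1r big1 ?addr0 // => j /negbTE ->.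
    by rewrite scale0r.
  apply/(weak0_ord_geP n3 he) => // j jl; rewrite (_ : (j == i) = false) //.
  by apply: contraTF jl => /eqP ->; rewrite -leqNgt.
rewrite comb_pair /tensor_space /subtensor.
elim: (index_enum _) => [|p s IH]; first by rewrite big_nil; exact: lspan0.
rewrite big_cons; have [h|/norP[h1 h2]] := boolP ((p.1 < l1)%N || (p.2 < l2)%N).
  by rewrite hc // scale0r add0r.
apply: lspan_scaleD IH; rewrite -!leqNgt in h1 h2.
by exists (alpha p.1); [exact: ho|exists (beta p.2); [exact: ho|]].
Qed.

Lemma J0P G : J0 M N G <-> exists c, G = Xi (comb c).
Proof.
have [ba _ _] := halpha; have [bb _ _] := hbeta.
split=> [hG|[c ->]].
  apply: (lspan_ind (P := fun G => exists c, G = Xi (comb c)) _ _ hG).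
    by exists (fun _ _ => 0); rewrite comb0 linear0.
  move=> a _ _ [w _ [eta _ <-]] [d ->].
  have [x ->] := basis_coord ba w; have [y ->] := basis_coord bb eta.
  by rewrite -XiE tens_comb -linearP -comb_lin; eexists.
rewrite comb_pair linear_sum /J0.
elim: (index_enum _) => [|p s IH]; first by rewrite big_nil; exact: lspan0.
rewrite big_cons linearZ /= XiE; apply: lspan_scaleD IH.
by exists (alpha p.1) => //; exists (beta p.2).
Qed.

(** These three properties are the whole interface to the Taylor coefficients: degrees, injectivity
    and orders below are deduced from them. *)
Lemma comb_expansion : exists g : coefs -> nat -> nat -> R[i],
  [/\ forall c, is_expansion (Xi (comb c)) (diag_poly (g c)),
      forall c (m : 'I_(M - 2)) (n : 'I_(N - 2)), g c m n = c m n &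
      forall c i k, g c i k != 0 ->
        exists m n, [/\ c m n != 0, (m <= i)%N & (n <= k)%N]].
Proof.
have [A hA] := adapted_taylor M3 halpha; have [B hB] := adapted_taylor N3 hbeta.
exists (fun c i k => \sum_p c p.1 p.2 * (A p.1 i * B p.2 k)); split=> [c|c m n|c i k].
- rewrite comb_pair linear_sum (eq_bigr (fun p => c p.1 p.2 *: jacobi_product (alpha
  p.1) (beta p.2)));
    last by move=> p _; rewrite linearZ /= XiE.
  apply: is_expansion_sum => p.
  exact: is_expansion_taylor (hA p.1).1 (hB p.2).1.
- rewrite (bigD1 (m, n)) //= (hA m).2 // (hB n).2 // !eqxx !mulr1 big1 ?addr0 // => p pmn.
  rewrite (hA p.1).2 // (hB p.2).2 // -natrM mulnb.
  rewrite (_ : (m == p.1 :> nat) && (n == p.2 :> nat) = false) ?mulr0 //.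
  apply: contraNF pmn; case: p => p q /= /andP[/eqP e1 /eqP e2].
  by apply/eqP; congr pair; apply/val_inj.
- move=> nz; have [p hp] : exists p, c p.1 p.2 * (A p.1 i * B p.2 k) != 0.
    apply: contrapT => none; move/negP: nz; apply; apply/eqP/big1 => p _.
    by apply/eqP; apply: contrapT => /negP h; apply: none; exists p.
  exists p.1, p.2; move: hp; rewrite !mulf_eq0 !negb_or => /and3P[c0 a0 b0]; split=> //.
    (* If i < m then i is also below M - 2, where the coefficient is a Kronecker symbol and
       vanishes. *)
    rewrite leqNgt; apply: contra a0 => im; rewrite (hA p.1).2 ?(ltn_trans im) //.
    by rewrite ltn_eqF.
  rewrite leqNgt; apply: contra b0 => im; rewrite (hB p.2).2 ?(ltn_trans im) //.
  by rewrite ltn_eqF.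
Qed.

Lemma comb_Czt l1 l2 c : Czt l1 l2 (Xi (comb c)) <-> supported l1 l2 c.
Proof.
have [g [gE gc gnz]] := comb_expansion.
split=> [[_ [P hP hdeg]]|hc].
  have {}hP : P = diag_poly (g c) := is_expansion_unique hP (gE c).
  rewrite hP in hdeg.
  have h2 := (@diag_poly_codeg_ge R (g c) l2).1 (fun j => let: And3 _ h _ := hdeg j in h).
  have h1 : forall i k, (k < l1)%N -> g c k i = 0.
    apply: (@diag_poly_codeg_ge R (fun i k => g c k i) l1).1 => j.
    by rewrite -poly_flip_diag; case: (hdeg j).
  move=> m n mn; rewrite -gc.
  by case/orP: mn => [ml|nl]; [exact: h1|exact: h2].
split.
  apply: (@J0_meromorphic R M N); [exact: leq_trans M3|exact: leq_trans N3|].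
  by apply/J0P; exists c.
have g0 i k : (i < l1)%N || (k < l2)%N -> g c i k = 0.
  move=> ik; apply/eqP; apply: contrapT => /negP /gnz[m [n [c0 mi nk]]].
  move/negP: c0; apply; apply/eqP/hc; case/orP: ik => h.
    by rewrite (leq_ltn_trans mi).
  by rewrite (leq_ltn_trans nk) // orbT.
exists (diag_poly (g c)) => // j; split.
- exact/edeg_le/size_diag_poly.
- by apply: (@diag_poly_codeg_ge R (g c) l2).2 => i k h; rewrite g0 // h orbT.
- rewrite poly_flip_diag.
  by apply: (@diag_poly_codeg_ge R (fun i k => g c k i) l1).2 => i k h; rewrite g0 // h.
Qed.

(** The coefficient c_mn is that of tau^m in the polynomial of index m + n. *)
Lemma comb_inj c d : Xi (comb c) = Xi (comb d) -> forall m n, c m n = d m n.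
Proof.
have [g [gE gc _]] := comb_expansion => e m n.
have E : diag_poly (g c) = diag_poly (g d).
  by apply: is_expansion_unique (gE c) _; rewrite e; exact: gE.
rewrite -!gc; have /(congr1 (fun P : {poly R[i]} => P`_m)) := congr1 (@^~ (m + n)%N) E.
by rewrite /= !coef_diag_poly ?leq_addr // addKn.
Qed.

Lemma comb_ord c : ord_fun (Xi (comb c)) = ord_tensor tens alpha beta (comb c).
Proof.
have [g [gE gc gnz]] := comb_expansion.
rewrite /ord_fun /ord_tensor; set P := xget _ _; set d := xget _ _.
(* [ord_tensor] chooses some matrix representing the tensor; the argument is carried out for the
   chosen one, which has the same image. *)
have dE : comb c = comb (fun m n => d m n).
  have : [set d : 'M[R[i]]_(M - 2, N - 2) |
      comb c = \sum_m \sum_n d m n *: tens (alpha m) (beta n)] d.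
    apply: (xgetI 0 (x := \matrix_(m, n) c m n)) => /=.
    by apply: eq_bigr => m _; apply: eq_bigr => n _; rewrite mxE.
  exact.
have -> : P = diag_poly (g (fun m n => d m n)).
  apply: (is_expansion_unique (G := Xi (comb c))); last by rewrite dE.
  by apply: (xgetI _ (gE c)).
clearbody P d; congr pair.
  under eq_fun do rewrite poly_flip_diag.
  apply: (@ereal_inf_codeg R (fun i k => g (fun m n => d m n) k i)) => [m [n dmn]|i k].
    by exists n; rewrite gc.
  by move=> /gnz[m [n [dmn mk ni]]]; exists m => //; exists n.
apply: (@ereal_inf_codeg R (g (fun m n => d m n))) => [n [m dmn]|i k].
  by exists m; rewrite gc.
by move=> /gnz[m [n [dmn mk ni]]]; exists n => //; exists m.
Qed.

Lemma subtensor_parity (s1 s2 : R[i]) F :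
  subtensor tens (@weak0_parity R M s1) (@weak0_parity R N s2) F ->
  forall z tau : C, Xi F (- z, tau) = s1 * s2 * Xi F (z, tau).
Proof.
move=> hF; apply: (lspan_ind (P := fun F => forall z tau : C,
  Xi F (- z, tau) = s1 * s2 * Xi F (z, tau)) _ _ hF).
  by move=> z tau; rewrite linear0 /= mulr0.
move=> a _ G [u hu [v hv <-]] IH z tau.
rewrite linearP XiE -[LHS]/(a * jacobi_product u v (- z, tau) + Xi G (- z, tau)).
rewrite -[X in _ = _ * X]/(a * jacobi_product u v (z, tau) + Xi G (z, tau)) IH.
by rewrite /jacobi_product /= mulNr hu hv; ring.
Qed.

End Isomorphism.
Theorem theorem3p20 (R : realType)
  (alpha : forall N : nat, 'I_(N - 2) -> weak0Type R N)
  (halpha : forall N : nat, (3 <= N)%N -> is_adapted_basis (@alpha N))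
  (M N : nat) (hM : (3 <= M)%N) (hN : (3 <= N)%N)
  (l1 l2 : nat) (hl1 : (l1 <= M - 3)%N) (hl2 : (l2 <= N - 3)%N)
  (T : lmodType R[i]) (tens : {bilinear weak0Type R M -> weak0Type R N -> T})
  (htens : is_tensor_product tens) :
  exists Xi : {linear T -> (R[i]^o * R[i]^o -> R[i]^o)},
    [/\ forall (w : weak0Type R M) (eta : weak0Type R N),
          Xi (tens w eta) = jacobi_product w eta,
        set_bij (tensor_space tens l1 l2) (J0 M N `&` Czt l1 l2) Xi,
        forall F : T, tensor_space tens l1 l2 F ->
          ord_fun (Xi F) = ord_tensor tens (@alpha M) (@alpha N) F &
        forall (s1 s2 : R[i]), s1 \in [:: 1; -1] -> s2 \in [:: 1; -1] ->
          forall F : T, tensor_space tens l1 l2 F ->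
          subtensor tens (@weak0_parity R M s1) (@weak0_parity R N s2) F ->
          forall z tau : R[i]^o, Xi F (- z, tau) = s1 * s2 * Xi F (z, tau)].
Proof.
(* The map is defined on all of [T]; only its restriction to the given subspace is then studied. *)
have [Xi XiE _] := htens _ (@jacobi_product R M N).
have hA := halpha M hM; have hB := halpha N hN.
have spaceP F := tensor_spaceP hM hN hA hB tens F hl1 hl2.
exists Xi; split=> //.
- split.
  + move=> F /spaceP[c hc ->]; split; first by apply/(J0P hA hB XiE); exists c.
    exact/(comb_Czt hM hN hA hB XiE).
  + move=> F G /set_mem/spaceP[c _ ->] /set_mem/spaceP[d _ ->].
    move=> /(comb_inj hM hN hA hB XiE) e.
    exact: eq_comb.
  + move=> G [/(J0P hA hB XiE)[c ->] /(comb_Czt hM hN hA hB XiE) hc].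
    by exists (comb (@alpha M) (@alpha N) tens c) => //; apply/spaceP; exists c.
- by move=> F /spaceP[c _ ->]; exact: (comb_ord hM hN hA hB XiE).
- by move=> s1 s2 _ _ F _; exact: subtensor_parity.
Qed.
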